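(* Let $g$ be an HCMU metric on a compact Riemann surface $M$ with character 1-form $\omega$ and Gauss curvature $K$, let $K_1=\max K$, $K_2=\min K$, and let $M^{*}=M\setminus\{\text{zeros and poles of }\omega\}$. Let $U\subseteq M^{*}$ be a connected open set with a complex coordinate $z=x+\sqrt{-1}\,y$ such that $\omega=dz$ on $U$, so that $$g=-\frac{4}{3}(K-K_{1})(K-K_{2})(K+K_{1}+K_{2})|dz|^{2}\quad\text{on }U.$$ Let $c\in\mathbb{R}$, let $\mathbb{Q}^3_c$ be the 3-dimensional space form of constant sectional curvature $c$, and let $r:(U,g)\to\mathbb{Q}^{3}_{c}$ be an isometric immersion with second fundamental form $$B=h_{11}dx^{2}+2h_{12}dxdy+h_{22}dy^{2}.$$ Then $r$ is a Weingarten surface if and only if $h_{12}$ is a constant.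
   Context: HCMU metrics. Let $M$ be a compact Riemann surface and $P_1,\dots,P_N\in M$. A conformal metric $g$ on $M\setminus\{P_1,\dots,P_N\}$, locally $g=e^{2\varphi}|dz|^2$, is called an HCMU metric on $M$ if its Gauss curvature $K$ is not constant and satisfies $K_{,zz}=0$; equivalently, $\nabla K:=\sqrt{-1}\,e^{-2\varphi}K_{\bar z}\frac{\partial}{\partial z}$ is a holomorphic vector field on $M\setminus\{P_1,\dots,P_N\}$. It is always assumed that $g$ has finite area $\int dg<\infty$ and finite Calabi energy $\int K^2\,dg<\infty$. Known facts fixing the notation: $\nabla K$ extends to a meromorphic vector field on $M$; the character 1-form of $g$ is the meromorphic 1-form $\omega$ on $M$ defined by $\omega(\nabla K)=\frac{\sqrt{-1}}{4}$. The curvature $K$ extends continuously to $M$; its maximum $K_1$ and minimum $K_2$ satisfy $K_1>0$ and either $K_1>K_2>-(K_1+K_2)$ or $K_2=-\frac12K_1$. On $M^{*}=M\setminus\{\text{zeros and poles of }\omega\}$ one has $K_2<K<K_1$, and with $p(K)=-\frac13(K-K_1)(K-K_2)(K+K_1+K_2)$, $$\frac{dK}{p(K)}=\omega+\bar\omega,\qquad g=4p(K)\,\omega\bar\omega .$$ In particular, in a coordinate $z=x+\sqrt{-1}\,y$ with $\omega=dz$, one has $dK=2p(K)\,dx$. An isometric immersion $r:U\to\mathbb{Q}^3_c$ with mean curvature $H$ (half the trace of the second fundamental form with respect to the metric, for a chosen unit normal) is called a Weingarten surface if $dK\wedge dH=0$ on $U$. *)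

(* Defs.v *)
From HB Require Import structures.
From mathcomp Require Import all_boot all_order all_algebra.
From mathcomp Require Import all_classical all_reals all_analysis.
From mathcomp.real_closed Require Export complex.
Set Implicit Arguments.
Unset Strict Implicit.
Unset Printing Implicit Defensive.
Import Order.TTheory GRing.Theory Num.Theory.
Import numFieldNormedType.Exports.
Local Open Scope classical_set_scope.
Local Open Scope complex_scope.
Local Open Scope ring_scope.

(* [complex R] with its norm topology and its structure of normed space over
   itself, so that [derivable f w 1] is complex differentiability. *)
Notation cplx R := ((complex R)^o) (only parsing).

Definition holomorphic_on (R : realType) (D : set (cplx R))
    (f : cplx R -> cplx R) : Prop :=
  forall w, D w -> derivable f w 1.

Definition sqnorm (R : realType) (w : cplx R) : R :=
  complex.Re w ^+ 2 + complex.Im w ^+ 2.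

(* Real partial derivatives in w = x + i y. *)
Definition hline (R : realType) (V : Type) (f : cplx R -> V) (w : cplx R) :
  R -> V := fun t => f (t +i* complex.Im w).
Definition vline (R : realType) (V : Type) (f : cplx R -> V) (w : cplx R) :
  R -> V := fun t => f (complex.Re w +i* t).
Definition dx (R : realType) (V : normedModType R) (f : cplx R -> V)
  (w : cplx R) : V := derive1 (hline f w) (complex.Re w).
Definition dy (R : realType) (V : normedModType R) (f : cplx R -> V)
  (w : cplx R) : V := derive1 (vline f w) (complex.Im w).

Fixpoint Ck_on (R : realType) (V : normedModType R) (k : nat)
    (D : set (cplx R)) (f : cplx R -> V) : Prop :=
  (forall w, D w -> {for w, continuous f}) /\
  (if k is k'.+1 then
     [/\ forall w, D w -> derivable (hline f w) (complex.Re w) 1,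
         forall w, D w -> derivable (vline f w) (complex.Im w) 1,
         Ck_on k' D (dx f) & Ck_on k' D (dy f)]
   else True).

(* Meant for open D only. *)
Definition smooth_on (R : realType) (V : normedModType R)
    (D : set (cplx R)) (f : cplx R -> V) : Prop :=
  forall k, Ck_on k D f.

(* Wirtinger derivatives; the real and imaginary parts are differentiated
   separately since [cplx R] is a normed space over [complex R], not over R. *)
Definition dxC (R : realType) (F : cplx R -> cplx R) (w : cplx R) : cplx R :=
  dx (fun v => complex.Re (F v) : R^o) w +i*
  dx (fun v => complex.Im (F v) : R^o) w.
Definition dyC (R : realType) (F : cplx R -> cplx R) (w : cplx R) : cplx R :=
  dy (fun v => complex.Re (F v) : R^o) w +i*
  dy (fun v => complex.Im (F v) : R^o) w.
Definition dz (R : realType) (F : cplx R -> cplx R) (w : cplx R) : cplx R :=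
  2^-1 * (dxC F w - 'i%C * dyC F w).
Definition dzbar (R : realType) (F : cplx R -> cplx R) (w : cplx R) : cplx R :=
  2^-1 * (dxC F w + 'i%C * dyC F w).
Definition toC (R : realType) (f : cplx R -> R) : cplx R -> cplx R :=
  fun w => (f w)%:C.

(* [has_order f a k]: f is meromorphic at a and does not vanish identically
   near a, with order k (a zero if k > 0, a pole if k < 0).  As 0^-1 = 0, f is
   given the conventional value 0 at a pole. *)
Definition has_order (R : realType) (f : cplx R -> cplx R) (a : cplx R)
    (k : int) : Prop :=
  exists h : cplx R -> cplx R,
    [/\ \forall w \near a, derivable h w 1,
        h a != 0 &
        \forall w \near a, f w = ((w - a : complex R) ^ k) * h w].

(* [coord] and [chart_inv] are meaningful only on [dom] and [coord @` dom]. *)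
Record chart (R : realType) (M : topologicalType) := Chart {
  dom : set M;
  coord : M -> cplx R;
  chart_inv : cplx R -> M;
  dom_open : open dom;
  img_open : open (coord @` dom);
  coordK : forall p, dom p -> chart_inv (coord p) = p;
  coord_continuous : forall p, dom p -> {for p, continuous coord};
  chart_inv_continuous :
    forall w, (coord @` dom) w -> {for w, continuous chart_inv} }.

Definition img (R : realType) (M : topologicalType) (u : chart R M) :
  set (cplx R) := coord u @` dom u.

Definition transition (R : realType) (M : topologicalType) (u v : chart R M) :
  cplx R -> cplx R := fun w => coord v (chart_inv u w).

Definition compatible (R : realType) (M : topologicalType) (u v : chart R M) :
    Prop :=
  holomorphic_on (coord u @` (dom u `&` dom v)) (transition u v) /\
  holomorphic_on (coord v @` (dom u `&` dom v)) (transition v u).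

(* Pointedness of the space only records that it is nonempty.  Second
   countability is not required: it is automatic for compact surfaces. *)
Record riemann_surface (R : realType) := RiemannSurface {
  rs_space :> ptopologicalType;
  rs_atlas : set (chart R rs_space);
  rs_cover : forall p, exists2 u, rs_atlas u & dom u p;
  rs_compat : forall u v, rs_atlas u -> rs_atlas v -> compatible u v;
  rs_hausdorff : hausdorff_space rs_space;
  rs_connected : connected [set: rs_space] }.

(* The complex coordinates of M: the charts of the maximal atlas. *)
Definition coordinate (R : realType) (M : riemann_surface R) (u : chart R M) :
    Prop :=
  forall v, rs_atlas v -> compatible u v.

Definition regular (R : realType) (M : riemann_surface R) (P : seq M) : set M :=
  [set p | p \notin P].

(* A smooth conformal metric on M minus P: in the coordinate u it is
   [density u] |du|^2, i.e. [density u] = e^(2 phi). *)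
Record conformal_metric (R : realType) (M : riemann_surface R) (P : seq M) :=
    ConformalMetric {
  density : chart R M -> cplx R -> R;
  density_gt0 : forall u, coordinate u -> forall p, dom u p -> regular P p ->
    0 < density u (coord u p);
  density_smooth : forall u, coordinate u ->
    smooth_on (coord u @` (dom u `&` regular P)) (density u : cplx R -> R^o);
  density_transition : forall u v, coordinate u -> coordinate v ->
    forall p, dom u p -> dom v p -> regular P p ->
    density u (coord u p) =
    density v (coord v p) * sqnorm (derive1 (transition u v) (coord u p)) }.

(* For the metric l |dw|^2 = e^(2 phi) |dw|^2. *)
Definition conf_exponent (R : realType) (l : cplx R -> R) : cplx R -> R :=
  fun w => ln (l w) / 2.

Definition conf_curvature (R : realType) (l : cplx R -> R) (w : cplx R) : R :=
  let phi : cplx R -> R^o := conf_exponent l in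
  - (dx (dx phi) w + dy (dy phi) w) / l w.

Definition is_gauss_curvature (R : realType) (M : riemann_surface R)
    (P : seq M) (g : conformal_metric P) (K : M -> R) : Prop :=
  forall u, coordinate u -> forall p, dom u p -> regular P p ->
    K p = conf_curvature (density g u) (coord u p).

Definition in_chart (R : realType) (M : topologicalType) (V : Type)
    (u : chart R M) (f : M -> V) : cplx R -> V :=
  fun w => f (chart_inv u w).

(* K_{,zz} = K_zz - 2 phi_z K_z, the (2,0)-part of the Hessian of K. *)
Definition cov_zz (R : realType) (l k : cplx R -> R) (w : cplx R) : cplx R :=
  dz (dz (toC k)) w - 2 * dz (toC (conf_exponent l)) w * dz (toC k) w.

Definition is_area_measure (R : realType) (M : riemann_surface R) (P : seq M)
    (g : conformal_metric P)
    (mu : {measure set (g_sigma_algebraType (@open M)) -> \bar R}) : Prop :=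
  mu [set p | p \in P] = 0%E /\
  forall u, coordinate u ->
  forall B : set (g_sigma_algebraType (@open M)),
    measurable B -> B `<=` dom u `&` regular P ->
    mu B = (\int[lebesgue_measure \x lebesgue_measure]_(
              q in [set q : R * R | (coord u @` B) (q.1 +i* q.2)])
              (density g u (q.1 +i* q.2))%:E)%E.

(* The area measure of g exists and is unique, so that the existential
   quantifier below could equally be a universal one. *)
Record is_hcmu (R : realType) (M : riemann_surface R) (P : seq M)
    (g : conformal_metric P) (K : M -> R) : Prop := IsHcmu {
  hcmu_curvature : is_gauss_curvature g K;
  hcmu_nonconstant : ~ exists k : R, forall p, regular P p -> K p = k;
  hcmu_cov_zz : forall u, coordinate u -> forall p, dom u p -> regular P p ->
    cov_zz (density g u) (in_chart u K) (coord u p) = 0;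
  hcmu_finite : exists2 mu, is_area_measure g mu &
    ((mu setT < +oo)%E /\ (\int[mu]_(p in regular P) ((K p) ^+ 2)%:E < +oo)%E) }.

(* Meromorphic 1-forms, the zero form excluded: [coef u] du in the
   coordinate u. *)
Record meromorphic_form (R : realType) (M : riemann_surface R) :=
    MeromorphicForm {
  coef : chart R M -> cplx R -> cplx R;
  coef_meromorphic : forall u, coordinate u -> forall p, dom u p ->
    exists k, has_order (coef u) (coord u p) k;
  coef_transition : forall u v, coordinate u -> coordinate v ->
    forall p, dom u p -> dom v p ->
    coef u (coord u p) =
    coef v (coord v p) * derive1 (transition u v) (coord u p) }.

Definition form_zeros (R : realType) (M : riemann_surface R)
    (omega : meromorphic_form M) : set M :=
  [set p | exists u, [/\ coordinate u, dom u p &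
     exists2 k : int, 0 < k & has_order (coef omega u) (coord u p) k]].

Definition form_poles (R : realType) (M : riemann_surface R)
    (omega : meromorphic_form M) : set M :=
  [set p | exists u, [/\ coordinate u, dom u p &
     exists2 k : int, k < 0 & has_order (coef omega u) (coord u p) k]].

(* The component of the vector field nabla K = i e^(-2 phi) K_zbar d/dz. *)
Definition grad_coef (R : realType) (l k : cplx R -> R) (w : cplx R) : cplx R :=
  'i%C * ((l w)^-1)%:C * dzbar (toC k) w.

(* omega (nabla K) = i / 4.  The poles of omega on M minus P, which are the
   zeros of nabla K, are left out: the identity of meromorphic objects is
   determined off them. *)
Definition is_character_form (R : realType) (M : riemann_surface R)
    (P : seq M) (g : conformal_metric P) (K : M -> R)
    (omega : meromorphic_form M) : Prop :=
  forall u, coordinate u ->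
  forall p, dom u p -> regular P p -> ~ form_poles omega p ->
    coef omega u (coord u p) *
    grad_coef (density g u) (in_chart u K) (coord u p) = 'i%C / 4.

(* The space form of curvature c, realized in R^4: the hyperplane x_0 = 0 if
   c = 0, the round sphere <x, x> = 1/c if c > 0, and the sheet x_0 > 0 of the
   hyperboloid <x, x> = 1/c if c < 0, where <,> is Euclidean for c >= 0 and
   Lorentzian (negative along x_0) for c < 0. *)
Definition ambient (R : realType) (c : R) (v w : 'rV[R]_4) : R :=
  \sum_(i < 4) (if (c < 0) && (i == ord0) then -1 else 1)
               * v ord0 i * w ord0 i.

Definition space_form (R : realType) (c : R) : set 'rV[R]_4 :=
  [set x : 'rV[R]_4 | if c == 0 then x ord0 ord0 = 0
           else ambient c x x = c^-1 /\ (c < 0 -> 0 < x ord0 ord0)].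

Definition space_form_tangent (R : realType) (c : R) (x : 'rV[R]_4) :
    set 'rV[R]_4 :=
  [set v : 'rV[R]_4 | if c == 0 then v ord0 ord0 = 0 else ambient c x v = 0].

(* r is an isometric immersion of the domain of z, with the metric l |dz|^2,
   into the space form; it is an immersion since l > 0. *)
Record isometric_immersion (R : realType) (M : topologicalType)
    (z : chart R M) (l : cplx R -> R) (c : R) (r : M -> 'rV[R]_4) : Prop :=
    IsometricImmersion {
  immersion_smooth : smooth_on (img z) (in_chart z r);
  immersion_in : forall p, dom z p -> space_form c (r p);
  immersion_xx : forall w, img z w ->
    ambient c (dx (in_chart z r) w) (dx (in_chart z r) w) = l w;
  immersion_xy : forall w, img z w ->
    ambient c (dx (in_chart z r) w) (dy (in_chart z r) w) = 0;
  immersion_yy : forall w, img z w ->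
    ambient c (dy (in_chart z r) w) (dy (in_chart z r) w) = l w }.

Record unit_normal (R : realType) (M : topologicalType)
    (z : chart R M) (c : R) (r N : M -> 'rV[R]_4) : Prop := UnitNormal {
  normal_smooth : smooth_on (img z) (in_chart z N);
  normal_tangent : forall p, dom z p -> space_form_tangent c (r p) (N p);
  normal_unit : forall p, dom z p -> ambient c (N p) (N p) = 1;
  normal_x : forall w, img z w ->
    ambient c (in_chart z N w) (dx (in_chart z r) w) = 0;
  normal_y : forall w, img z w ->
    ambient c (in_chart z N w) (dy (in_chart z r) w) = 0 }.

(* Coefficients of B = h11 dx^2 + 2 h12 dx dy + h22 dy^2.  The Levi-Civita
   connection of the space form is the tangential part of the flat one of R^4,
   and N is tangent to the space form, hence h_ij = <r_ij, N>. *)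
Definition h11 (R : realType) (M : topologicalType) (z : chart R M) (c : R)
    (r N : M -> 'rV[R]_4) (w : cplx R) : R :=
  ambient c (dx (dx (in_chart z r)) w) (in_chart z N w).
Definition h12 (R : realType) (M : topologicalType) (z : chart R M) (c : R)
    (r N : M -> 'rV[R]_4) (w : cplx R) : R :=
  ambient c (dx (dy (in_chart z r)) w) (in_chart z N w).
Definition h22 (R : realType) (M : topologicalType) (z : chart R M) (c : R)
    (r N : M -> 'rV[R]_4) (w : cplx R) : R :=
  ambient c (dy (dy (in_chart z r)) w) (in_chart z N w).

Definition mean_curvature (R : realType) (M : topologicalType) (z : chart R M)
    (l : cplx R -> R) (c : R) (r N : M -> 'rV[R]_4) (w : cplx R) : R :=
  (h11 z c r N w + h22 z c r N w) / (2 * l w).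

(* dK /\ dH = 0 on the domain of z. *)
Definition weingarten (R : realType) (M : topologicalType) (z : chart R M)
    (l : cplx R -> R) (c : R) (K : M -> R) (r N : M -> 'rV[R]_4) : Prop :=
  let k : cplx R -> R^o := in_chart z K in
  let H : cplx R -> R^o := mean_curvature z l c r N in
  forall w, img z w -> dx k w * dy H w - dy k w * dx H w = 0.

Definition is_max (R : realType) (T : Type) (f : T -> R) (m : R) : Prop :=
  (exists p, f p = m) /\ forall p, f p <= m.
Definition is_min (R : realType) (T : Type) (f : T -> R) (m : R) : Prop :=
  (exists p, f p = m) /\ forall p, m <= f p.

(* Main.v *)
Require Import Defs.
From mathcomp Require Import all_boot all_order all_algebra.
From mathcomp Require Import all_classical all_reals all_analysis.
From mathcomp Require Import ring lra zify.
Set Implicit Arguments.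
Unset Strict Implicit.
Unset Printing Implicit Defensive.
Import Order.TTheory GRing.Theory Num.Theory.
Import numFieldNormedType.Exports.
Local Open Scope classical_set_scope.
Local Open Scope complex_scope.
Local Open Scope ring_scope.

(* Where omega = dz, the metric l |dz|^2 satisfies K_x = l / 2 and K_y = 0, so
   l_y = 0, and the curvature equation integrates along x to l = P(K) with P a
   cubic polynomial.  Write h11 = l H + u, h22 = l H - u, h12 = b; since
   K_y = 0 < K_x, the surface is Weingarten iff H_y = 0.  The Codazzi equations
   become (h11)_y = b_x and (h22)_x - b_y = H l_x, and the Gauss equation is
   u^2 + b^2 = l^2 (H^2 - K + c).

   If b is constant, then (h11)_y = 0, and the y-derivative of the Gauss equation
   is h11 (h22)_y = 0.  On an open set where H_y <> 0 this forces h11 = 0, so that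
   l^2 (K - c) = - b^2 there, a nontrivial polynomial equation for K.

   If H_y = 0, put F = u^2 + b^2 and G = l H_x, two functions of x, and suppose
   that b is not constant.  The compatibility of the first order system satisfied
   by (u, b) yields G = C F with C constant and F F'' - F'^2 = 2 F G^2 near some
   point.  With s = H^2 - K + c these relations say that dH/dK = 2 C s and
   s^2 P'' + (s P' + P) (2 C H s - 1/2) = 0: the function H of K satisfies a
   Riccati equation and is algebraic.  For C = 0 this is a nontrivial polynomial
   equation for K.  For C <> 0 the Riccati equation is, up to an affine change of
   variables, the one of the Airy equation, which has no algebraic solution. *)

(** * A Riccati vector field without invariant algebraic curves *)

Section riccati_recursion.
Context {R : realFieldType}.
(** With D = d/dt + (h^2 - q) d/dh, this is the equation D F = (d h + beta) F for F = sum of [y k]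
    h^(d-k), read from the leading coefficient down. The hypothesis [yd] turns the case k = d - 1 of
    [yS] into the equation for h^0. *)
Variables (q beta : {poly R}) (y : nat -> {poly R}) (d : nat).
Hypothesis size_q : size q = 2%N.
Hypothesis y0 : y 0%N != 0.
Hypothesis y1 : y 1%N = (y 0%N)^`() - beta * y 0%N.
Hypothesis yS : forall k, (k < d)%N ->
  k.+2%:R *: y k.+2 =
  (y k.+1)^`() - beta * y k.+1 - (d - k)%:R *: (q * y k).
Hypothesis yd : y d.+1 = 0.
Hypothesis d_gt0 : (0 < d)%N.

Let n := (size (y 0%N)).-1.
Let a := q`_1.
Let lc := lead_coef (y 0%N).

Let size_y0 : size (y 0%N) = n.+1.
Proof. by rewrite prednK // size_poly_gt0. Qed.

Let lc_neq0 : lc != 0. Proof. by rewrite lead_coef_eq0. Qed.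

Let a_neq0 : a != 0.
Proof. by rewrite /a -[1%N]/(2.-1) -size_q -lead_coefE lead_coef_eq0 -size_poly_gt0 size_q. Qed.

Let size_qM (p : {poly R}) : (size (q * p)%R <= (size p).+1)%N.
Proof. by apply: leq_trans (size_polyMleq q p) _; rewrite size_q. Qed.

Let coef_qM (p : {poly R}) i : (size p <= i.+1)%N -> (q * p)`_i.+1 = a * p`_i.
Proof.
move=> sp; rewrite coefM 2!big_ord_recl /= big1 => [|j _]; last first.
  by rewrite nth_default ?mul0r // size_q.
by rewrite subn0 (nth_default _ sp) mulr0 add0r addr0 /bump /= add1n subn1.
Qed.

Let natS_unit k : k.+1%:R != 0 :> R. Proof. by rewrite pnatr_eq0. Qed.

(** The product with [beta] raises the degree by m > 0 at each step and dominates both other terms.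
    So [y k] has degree exactly n + k m and cannot vanish, against [yd]. *)
Lemma recursion_nonconstant : (1 < size beta)%N -> False.
Proof.
set m := (size beta).-1 => sb.
have size_b : size beta = m.+1 by rewrite prednK // ltnW.
have m_gt0 : (0 < m)%N by move: sb; rewrite size_b.
have step k (p : {poly R}) : size (y k) = (n + k * m).+1 -> (size p < (n + k.+1 * m).+1)%N ->
    k.+1%:R *: y k.+1 = (y k)^`() - beta * y k - p ->
    size (y k.+1) = (n + k.+1 * m).+1.
  move=> sk sp eq_y.
  have yk0 : y k != 0 by rewrite -size_poly_gt0 sk.
  have sby : size (- (beta * y k)) = (n + k.+1 * m).+1.
    by rewrite size_polyN size_mul -?size_poly_gt0 ?size_b ?sk //=; lia.
  rewrite -(size_scale (y k.+1) (natS_unit k)) eq_y addrAC addrC size_polyDl //.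
  rewrite sby (leq_ltn_trans (size_polyD _ _)) // size_polyN gtn_max sp andbT.
  by rewrite (ltn_trans (lt_size_deriv yk0)) // sk ltnS mulSn; lia.
have sy k : (k <= d)%N -> size (y k) = (n + k * m).+1 /\
    size (y k.+1) = (n + k.+1 * m).+1.
  elim: k => [_|k IH kd].
    split; first by rewrite size_y0 mul0n addn0.
    apply: (step 0%N 0); rewrite ?size_y0 ?mul0n ?addn0 ?size_poly0 //.
    by rewrite scale1r subr0 y1.
  have [sk sk1] := IH (ltnW kd); split => //.
  apply: (step k.+1 ((d - k)%:R *: (q * y k))) => //; last exact: yS.
  apply: leq_ltn_trans (size_scale_leq _ _) _.
  by apply: leq_ltn_trans (size_qM _) _; rewrite sk; nia.
by have [_] := sy d (leqnn d); rewrite yd size_poly0.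
Qed.

(* Each [q * _] multiplies the leading coefficient by [a]: the even terms of the
   sequence have leading coefficient [(- a) ^+ j] times that of [y 0], up to a
   positive factor. *)
Let even_top j := exists2 e : R, 0 < e & (size (y j.*2) <= (n + j).+1)%N /\
  (y j.*2)`_(n + j) = (- a) ^+ j * e * lc.

Section constant.
Variable b : R.
Hypothesis beta_b : beta = b%:P.

Let odd_top j := exists2 e : R, 0 < e & (size (y j.*2.+1) <= (n + j).+1)%N /\
  (y j.*2.+1)`_(n + j) = - b * (- a) ^+ j * e * lc.

Let scale_b (p : {poly R}) : b *: p = beta * p.
Proof. by rewrite beta_b mul_polyC. Qed.

Let coef_deriv_top (p : {poly R}) i : (size p <= i.+1)%N -> p^`()`_i = 0.
Proof. by move=> sp; rewrite coef_deriv nth_default // mul0rn. Qed.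

Let size_derivS (p : {poly R}) i : (size p <= i.+1)%N -> (size p^`() <= i)%N.
Proof.
move=> sp; apply/leq_sizeP => j ij; rewrite coef_deriv nth_default ?mul0rn //.
exact: leq_trans sp _.
Qed.

Let even_top0 : even_top 0.
Proof.
exists 1 => //; rewrite addn0 size_y0; split => //.
by rewrite expr0 !mul1r /lc lead_coefE.
Qed.

Let odd_top0 : odd_top 0.
Proof.
have s0 : (size (y 0%N) <= n.+1)%N by rewrite size_y0.
exists 1 => //; rewrite addn0; split.
  rewrite y1 beta_b mul_polyC; apply: leq_trans (size_polyD _ _) _.
  rewrite size_polyN geq_max (leq_trans (size_derivS s0)) //=.
  exact: leq_trans (size_scale_leq _ _) s0.
rewrite y1 beta_b mul_polyC coefB coefZ coef_deriv_top // sub0r.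
by rewrite /lc lead_coefE -/n expr0; ring.
Qed.

(** Only [q * y j.*2] reaches degree n + j + 1, so nothing can cancel it. *)
Let even_topS j : (j.*2 < d)%N -> even_top j -> odd_top j -> even_top j.+1.
Proof.
move=> jd [e e0 [se ce]] [t t0 [so co]].
have eq_y : y j.+1.*2 = j.*2.+2%:R^-1 *:
    ((y j.*2.+1)^`() - b *: y j.*2.+1 - (d - j.*2)%:R *: (q * y j.*2)).
  by rewrite scale_b -yS // scalerA mulVf // scale1r.
exists (j.*2.+2%:R^-1 * (d - j.*2)%:R * e).
  by rewrite !mulr_gt0 // ?invr_gt0 ?ltr0n // subn_gt0.
rewrite eq_y addnS; split.
  apply: leq_trans (size_scale_leq _ _) _.
  apply: leq_trans (size_polyD _ _) _; rewrite geq_max size_polyN; apply/andP; split.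
    apply: leq_trans (size_polyD _ _) _; rewrite geq_max size_polyN.
    apply/andP; split; first by apply: leq_trans (size_derivS so) _; lia.
    by apply: leq_trans (size_scale_leq _ _) _; apply: leq_trans so _.
  by apply: leq_trans (size_scale_leq _ _) _; apply: leq_trans (size_qM _) _.
rewrite coefZ !coefB !coefZ coef_qM // ce coef_deriv_top; last exact: leqW.
by rewrite (nth_default _ so) exprS; ring.
Qed.

(** The contributions of [b *: y j.+1.*2] and [q * y j.*2.+1] both carry the factor - b (- a)^(j+1)
    with a positive weight, so they add up. *)
Let odd_topS j : (j.*2.+1 < d)%N -> even_top j.+1 -> odd_top j -> odd_top j.+1.
Proof.
move=> jd [e e0 [se ce]] [t t0 [so co]].
have eq_y : y j.+1.*2.+1 = j.*2.+3%:R^-1 *: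
    ((y j.+1.*2)^`() - b *: y j.+1.*2 - (d - j.*2.+1)%:R *: (q * y j.*2.+1)).
  by rewrite scale_b -yS // scalerA mulVf // scale1r.
exists (j.*2.+3%:R^-1 * (e + (d - j.*2.+1)%:R * t)).
  by rewrite mulr_gt0 ?invr_gt0 ?ltr0n // addr_gt0 // mulr_gt0 // ltr0n subn_gt0.
rewrite eq_y addnS; rewrite addnS in se ce; split.
  apply: leq_trans (size_scale_leq _ _) _.
  apply: leq_trans (size_polyD _ _) _; rewrite geq_max size_polyN; apply/andP; split.
    apply: leq_trans (size_polyD _ _) _; rewrite geq_max size_polyN.
    apply/andP; split; first by apply: leq_trans (size_derivS se) _.
    by apply: leq_trans (size_scale_leq _ _) _.
  by apply: leq_trans (size_scale_leq _ _) _; apply: leq_trans (size_qM _) _.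
rewrite coefZ !coefB !coefZ coef_qM // ce co coef_deriv_top //.
by rewrite exprS; ring.
Qed.

Let tops j : (j.*2 <= d.+1)%N ->
  even_top j /\ ((j.*2 <= d)%N -> odd_top j).
Proof.
elim: j => [_|j IH jd]; first by split.
have [|ej oj] := IH; first by rewrite doubleS in jd; lia.
have ejS : even_top j.+1.
  by apply: even_topS => //; try apply: oj; rewrite doubleS in jd; lia.
split => // jd'; have jd1 : (j.*2.+1 < d)%N by rewrite doubleS in jd'.
by apply: odd_topS => //; apply: oj; apply: ltnW; apply: ltnW.
Qed.

(* If [b = 0], the odd terms lose one degree and what remains of the leading
   coefficient is again of constant sign for [j > 0]; it is read off ['X * _]
   since the degree [n + j - 1] is negative when [n = j = 0]. *)
Let odd_low j := exists2 e : R, 0 <= e /\ ((0 < j)%N -> 0 < e) &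
  (size (y j.*2.+1) <= n + j)%N /\
  ('X * y j.*2.+1)`_(n + j) = (- a) ^+ j * e * lc.

Let coef_XderivM (p : {poly R}) i : ('X * p^`())`_i = i%:R * p`_i.
Proof.
by rewrite coefXM; case: i => [|i] /=; rewrite ?mul0r // coef_deriv mulr_natl.
Qed.

Let coef_qXM (p : {poly R}) i : (size p <= i)%N -> (q * p)`_i = a * ('X * p)`_i.
Proof.
rewrite coefXM; case: i => [|i] sp; last exact: coef_qM.
by move: sp; rewrite size_poly_leq0 => /eqP ->; rewrite !mulr0 coef0.
Qed.

Let odd_lows j : b = 0 -> (j.*2 <= d)%N -> odd_low j.
Proof.
move=> b0; elim: j => [_|j IH jd].
  have s0 : (size (y 0%N) <= n.+1)%N by rewrite size_y0.
  exists n%:R; first by rewrite ler0n.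
  rewrite y1 beta_b b0 mul0r subr0 addn0 size_derivS //; split => //.
  by rewrite coef_XderivM expr0 mul1r /lc lead_coefE -/n.
have [|[e e0 [se ce]] _] := @tops j.+1; first by lia.
have [|t [t0 _] [so co]] := IH; first by lia.
have eq_y : y j.+1.*2.+1 = j.*2.+3%:R^-1 *:
    ((y j.+1.*2)^`() - (d - j.*2.+1)%:R *: (q * y j.*2.+1)).
  rewrite -[X in _ *: (X - _)]subr0 -[X in _ - X - _](mul0r (y j.+1.*2)).
  by rewrite -polyC0 -b0 -beta_b -yS ?scalerA ?mulVf ?scale1r //.
exists (j.*2.+3%:R^-1 * ((n + j.+1)%:R * e + (d - j.*2.+1)%:R * t)).
  have : 0 < j.*2.+3%:R^-1 * ((n + j.+1)%:R * e + (d - j.*2.+1)%:R * t).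
    rewrite mulr_gt0 ?invr_gt0 ?ltr0n // ltr_wpDr // ?mulr_ge0 //.
    by rewrite mulr_gt0 // ltr0n addnS.
  by split => //; apply: ltW.
rewrite eq_y; split.
  apply: leq_trans (size_scale_leq _ _) _.
  apply: leq_trans (size_polyD _ _) _; rewrite geq_max size_polyN; apply/andP; split.
    by rewrite size_derivS.
  apply: leq_trans (size_scale_leq _ _) _; apply: leq_trans (size_qM _) _.
  by rewrite addnS.
rewrite -(scalerAr _ 'X) coefZ mulrBr coefB coef_XderivM ce -(scalerAr _ 'X) coefZ addnS.
rewrite coefXM /= coef_qXM // co exprS; ring.
Qed.

(** If d is odd, [y d.+1] is an even term and its top coefficient is nonzero. If d is even it is an
    odd term: its top coefficient forces b = 0, and then the next lower one is nonzero because d / 2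
    > 0. *)
Lemma recursion_constant : False.
Proof.
have [dE|dE] := boolP (odd d).
  have dD : d.+1 = (d./2.+1).*2 by lia.
  have [|[e e0 [_ ce]] _] := @tops d./2.+1; first by lia.
  move: ce; rewrite -dD yd coef0 => /esym/eqP; rewrite !mulf_eq0 expf_eq0 oppr_eq0.
  by rewrite (negPf a_neq0) (negPf lc_neq0) gt_eqF ?andbF.
have dD : d.+1 = (d./2).*2.+1 by lia.
have [|_ /(_ _)[|t t0 [_ co]]] := @tops d./2; [by lia|by lia|].
move: co; rewrite -dD yd coef0 => /esym/eqP; rewrite !mulf_eq0 expf_eq0 !oppr_eq0.
rewrite (negPf a_neq0) (negPf lc_neq0) (gt_eqF t0) andbF !orbF => /eqP b0.
have [|t' [_ t'0] [_ co']] := @odd_lows d./2 b0; first by lia.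
move: co'; rewrite -dD yd mulr0 coef0 => /esym/eqP; rewrite !mulf_eq0 expf_eq0 oppr_eq0.
by rewrite (negPf a_neq0) (negPf lc_neq0) gt_eqF ?andbF // t'0 //; lia.
Qed.

End constant.

Lemma recursion_absurd : False.
Proof.
have [sb|/recursion_nonconstant //] := leqP (size beta) 1.
exact: recursion_constant (size1_polyC sb).
Qed.

End riccati_recursion.

(** * Darboux polynomials and differential ideals of the Riccati field *)

Section riccati_derivation.
Context {R : realFieldType}.
Variable q : {poly R}.

(* A bivariate polynomial is seen as a polynomial in h over R[t]; this is its
   derivative along the vector field d/dt + (h^2 - q(t)) d/dh. *)
Definition riccati_deriv (F : {poly {poly R}}) : {poly {poly R}} :=
  map_poly (@deriv R) F + F^`() * ('X^2 - q%:P).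

Lemma coef_riccati_deriv F i : (riccati_deriv F)`_i =
  (F`_i)^`() + (if i is j.+1 then j%:R * F`_j else 0) - i.+1%:R * (q * F`_i.+1).
Proof.
rewrite coefD coef_map /= -addrA; congr (_ + _).
rewrite mulrBr coefB coefMXn coefMC !coef_deriv.
by case: i => [|[|i]] /=; rewrite ?subn0 ?subSS ?subn0 ?subn1 /= -!(mulr_natl F`_ _); ring.
Qed.

Hypothesis size_q : size q = 2%N.

(** Comparing the powers of h from the top down gives the recursion excluded above, for degree d + 1
    in h. *)
Lemma riccati_no_darboux (F : {poly {poly R}}) (d : nat) (beta : {poly R}) :
  size F = d.+2 ->
  riccati_deriv F = ((d.+1%:R)%:P * 'X + beta%:P) * F -> False.
Proof.
move=> sF eqF.
(* The guard supplies the final zero of the recursion, where truncated subtraction would repeat the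
   constant coefficient. *)
pose y k := if (k <= d.+1)%N then F`_(d.+1 - k) else 0.
have coefE i : (F`_i)^`() + (if i is j.+1 then j%:R * F`_j else 0)
    - i.+1%:R * (q * F`_i.+1) =
    d.+1%:R * (if i is j.+1 then F`_j else 0) + beta * F`_i.
  rewrite -coef_riccati_deriv eqF mulrDl coefD -mulrA !coefCM coefXM.
  by case: i.
apply: (@recursion_absurd R q beta y d.+1) => //.
- by rewrite /y /= subn0 -[d.+1]/(d.+2.-1) -sF -lead_coefE lead_coef_eq0 -size_poly_gt0 sF.
- rewrite /y /= subn0 subn1 /=; have := coefE d.+1.
  rewrite (nth_default _ (eq_leq sF)) mulr0 mulr0 subr0.
  move=> e; apply/eqP; rewrite -subr_eq0; apply/eqP.
  move/eqP: e; rewrite -subr_eq0 => /eqP e.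
  by rewrite -[RHS]oppr0 -[in RHS]e -natr1; ring.
- move=> k kd; rewrite /y kd (ltnW kd).
  have [j dE] : exists j, d = (k + j)%N by exists (d - k)%N; lia.
  have -> : (d.+1 - k.+1 = j)%N by lia.
  have -> : (d.+1 - k = j.+1)%N by lia.
  have := coefE j; rewrite dE; case: j dE => [|j] dE.
    rewrite ltnNge (_ : (k + 0).+1 = k.+1) ?leqnn /=; last by lia.
    move=> e; rewrite scaler0 -!mul_polyC polyC_natr; move/eqP: e; rewrite -subr_eq0 => /eqP e.
    by rewrite -[LHS]e; ring.
  have -> : (k.+1 < (k + j.+1).+1)%N by lia.
  have -> : ((k + j.+1).+1 - k.+2 = j)%N by lia.
  move=> e; rewrite -!mul_polyC !polyC_natr; apply/eqP; rewrite -subr_eq0; apply/eqP.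
  move/eqP: e; rewrite -subr_eq0 => /eqP e.
  rewrite -[RHS]oppr0 -[in RHS]e.
  have -> : (k + j.+1).+1%:R = k.+2%:R + j%:R :> {poly R} by rewrite -natrD; congr _%:R; lia.
  by ring.
- by rewrite /y ltnn.
Qed.

(* The hypotheses say that [V] is a saturated differential ideal that meets
   R[t] trivially.  In an element of least degree in h and then of least leading
   coefficient, this coefficient divides what is needed for the element to
   divide its own derivative. *)
Lemma riccati_ideal_eq0 (V : {poly {poly R}} -> Prop) :
  (forall F G, V F -> V G -> V (F + G)) ->
  (forall F G, V F -> V (G * F)) ->
  (forall F, V F -> V (riccati_deriv F)) ->
  (forall (p : {poly R}) F, p != 0 -> V (p%:P * F) -> V F) ->
  ~ V 1 ->
  forall F, V F -> F = 0.
Proof.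
move=> VD VM Vd Vsat V1 F.
(* A nonzero p of R[t] in [V] would put 1 in [V] by saturation. *)
have VC (p : {poly R}) : V p%:P -> p = 0.
  have [//|p0] := eqVneq p 0; rewrite -[p%:P]mulr1 => /(Vsat _ _ p0) /V1 [].
have [n] := ubnP (size F); elim: n F => // n IHn F; rewrite ltnS => sFn.
have [m] := ubnP (size (lead_coef F)); elim: m F sFn => // m IHm F sFn; rewrite ltnS => sa VF.
have [sFn'|sF] := ltnP (size F) n; first exact: IHn.
have {}sF : size F = n by apply/eqP; rewrite eqn_leq sFn.
clear sFn.
case: n sF IHn IHm => [/eqP|[|d] sF IHn IHm]; first by rewrite size_poly_eq0 => /eqP.
  by move: VF; have /eq_leq/size1_polyC -> := sF => /VC ->.
(* The choice of [e] makes a D(F) - ((d + 1) a h + e) F lose its coefficients of h^(d+2) and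
   h^(d+1). This element of [V] then vanishes by induction on the degree. *)
pose a := lead_coef F; pose e := a^`() - F`_d.
have aE : F`_d.+1 = a by rewrite /a lead_coefE sF.
have a0 : a != 0 by rewrite lead_coef_eq0 -size_poly_gt0 sF.
have F_big i : (d.+1 < i)%N -> F`_i = 0 by move=> di; rewrite nth_default ?sF.
have Ge : a%:P * riccati_deriv F = ((d.+1%:R * a)%:P * 'X + e%:P) * F.
  apply/eqP; rewrite -subr_eq0; apply/eqP; apply: IHn; last first.
    by rewrite -mulNr; apply: VD; apply: VM => //; apply: Vd.
  rewrite ltnS; apply/leq_sizeP => i di.
  rewrite coefB mulrDl coefD -mulrA !coefCM coef_riccati_deriv coefXM.
  move: di; rewrite leq_eqVlt => /orP[/eqP <-|].
    by rewrite aE (F_big d.+2) //= /e -natr1; ring.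
  rewrite leq_eqVlt => /orP[/eqP <-|di].
    rewrite /= aE (F_big d.+2) // (F_big d.+3) // deriv0; ring.
  case: i di => //= i di; rewrite !F_big ?deriv0; [ring|lia|lia|lia].
(* Without the common factor, [a1] and [e1] are coprime, and the identity forces [a1] to divide
   every coefficient of F. *)
pose g := gcdp a e.
have g0 : g != 0 by rewrite gcdp_eq0 (negPf a0).
pose a1 := a %/ g; pose e1 := e %/ g.
have aE1 : a = a1 * g by rewrite divpK // dvdp_gcdl.
have eE1 : e = e1 * g by rewrite divpK // dvdp_gcdr.
have a10 : a1 != 0 by apply: contra_neq a0; rewrite aE1 => ->; rewrite mul0r.
have co : coprimep a1 e1 by apply: coprimep_div_gcd; rewrite a0.
have G1 : a1%:P * riccati_deriv F = ((d.+1%:R * a1)%:P * 'X + e1%:P) * F.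
  apply: (@mulfI _ g%:P); first by rewrite polyC_eq0.
  by rewrite mulrA -polyCM [g * a1]mulrC -aE1 Ge eE1 aE1 !polyCM; ring.
have a1F i : a1 %| F`_i.
  have := congr1 (fun p : {poly {poly R}} => p`_i) G1.
  rewrite -(Gauss_dvdpr _ co) mulrDl coefD -mulrA !coefCM => eq_i.
  have -> : e1 * F`_i = a1 * (riccati_deriv F)`_i - d.+1%:R * a1 * ('X * F)`_i.
    by rewrite eq_i; ring.
  apply: dvdp_sub; first exact: dvdp_mulr.
  by rewrite -mulrA mulrCA dvdp_mulr.
pose F1 := map_poly (fun p => p %/ a1) F.
have FE : F = a1%:P * F1.
  by apply/polyP => i; rewrite coefCM coef_map_id0 ?div0p // mulrC divpK.
have VF1 : V F1 by apply: (Vsat a1) => //; rewrite -FE.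
(* If [a1] is constant, F is a Darboux polynomial, which is excluded. Otherwise F / a1 lies in [V]
   by saturation and its leading coefficient has smaller degree. *)
have [sa1|sa1] := leqP (size a1) 1.
  exfalso; have [c a1E] : exists c, a1 = c%:P by exists a1`_0; apply: size1_polyC.
  have c0 : c != 0 by rewrite -polyC_eq0 -a1E.
  apply: (@riccati_no_darboux F d (c^-1 *: e1) sF).
  apply: (@mulfI _ a1%:P); first by rewrite polyC_eq0.
  rewrite G1 mulrA; congr (_ * _); rewrite mulrDr; congr (_ + _).
    by rewrite polyCM mulrA [a1%:P * _]mulrC.
  by rewrite -polyCM {1}a1E mul_polyC scalerA mulfV ?scale1r.
have lF1 : a = a1 * lead_coef F1 by rewrite /a {1}FE lead_coefM lead_coefC.
have l0 : lead_coef F1 != 0 by apply: contra_neq a0; rewrite lF1 => ->; rewrite mulr0.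
rewrite FE (IHm F1) ?mulr0 //.
  rewrite -sF FE size_mul ?polyC_eq0 // ?size_polyC ?a10 //.
  by rewrite -lead_coef_eq0.
move: sa; rewrite -/a lF1 size_mul //.
by move=> le_m; apply: leq_trans le_m; rewrite -ltnS prednK ?addn_gt0 ?(ltnW sa1) // -addn2 addnC leq_add2r.
Qed.

End riccati_derivation.

(** * Partial derivatives on open sets of the complex plane *)

Section boxes.
Context {R : realType}.
Implicit Types (w : cplx R) (A D : set (cplx R)).

Lemma cplx_eta w : complex.Re w +i* complex.Im w = w.
Proof. by case: w. Qed.

(** Squares replace discs because they are products of intervals: one-variable arguments along
    horizontal and vertical segments stay inside. *)
Definition box w (e : R) : set (cplx R) :=
  [set v | `|complex.Re v - complex.Re w| < e /\
           `|complex.Im v - complex.Im w| < e].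

Lemma nbhs_box w (A : set (cplx R)) :
  nbhs w A <-> exists2 e : R, 0 < e & box w e `<=` A.
Proof.
split=> [/nbhs_ballP[[e i] /=]|[e e0 eA]].
  (* A positive radius in R[i] is real, and the square of half-side e / 2 fits in the disc of radius
     e. *)
  rewrite ltcE /= => /andP[/eqP -> e0 eA]; exists (e / 2); first by rewrite divr_gt0.
  move=> v [vx vy]; apply: eA; rewrite -ball_normE /ball_ /= distrC normc_def ltcR.
  have -> : complex.Re (v - w) = complex.Re v - complex.Re w by case: v w {vx vy} => [? ?] [].
  have -> : complex.Im (v - w) = complex.Im v - complex.Im w by case: v w {vx vy} => [? ?] [].
  rewrite -(ltr_pXn2r (ltn0Sn 1)) ?nnegrE ?sqrtr_ge0 ?ltW // sqr_sqrtr ?addr_ge0 ?sqr_ge0 //.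
  move: vx vy; rewrite -(real_normK (num_real (_ - complex.Re w))).
  rewrite -(real_normK (num_real (_ - complex.Im w))).
  move: `|_| `|complex.Im _ - _| (normr_ge0 (complex.Re v - complex.Re w)) (normr_ge0 (complex.Im v - complex.Im w)) => x y *.
  nra.
apply/nbhs_ballP; exists (e%:C); first by rewrite /= ltcR.
move=> v; rewrite -ball_normE /ball_ /= distrC => vw; apply: eA; split.
  have := le_lt_trans (normc_ge_Re _) vw; rewrite ltcR.
  by case: v w {vw} => [? ?] [].
have : `|complex.Im (v - w : R[i])|%:C < e%:C.
  apply: le_lt_trans vw; rewrite normc_def lecR -sqrtr_sqr.
  by rewrite ler_wsqrtr // lerDr sqr_ge0.
by rewrite ltcR; case: v w {vw} => [? ?] [].
Qed.

Lemma box_self w (e : R) : 0 < e -> box w e w.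
Proof. by move=> e0; split; rewrite subrr normr0. Qed.

Lemma open_box D w : open D -> D w -> exists2 e : R, 0 < e & box w e `<=` D.
Proof. by move=> oD Dw; apply/nbhs_box; apply: open_nbhs_nbhs. Qed.

Lemma nbhs_real_ball (x : R) (e : R) (P : R -> Prop) : 0 < e ->
  (forall t, `|t - x| < e -> P t) -> \forall t \near x, P t.
Proof.
move=> e0 H; apply/nbhs_ballP; exists e => //= t; rewrite -ball_normE /ball_ /= distrC.
exact: H.
Qed.

End boxes.

Section partial_derivatives.
Context {R : realType}.
Implicit Types (w : cplx R) (D : set (cplx R)).

(** The boolean selects the variable, [true] for x and [false] for y, so that both partial
    derivatives are treated at once. *)
Definition coordc (b : bool) w : R := if b then complex.Re w else complex.Im w.
Definition line (V : Type) (b : bool) (f : cplx R -> V) w : R -> V :=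
  if b then hline f w else Defs.vline f w.
Definition pd (V : normedModType R) (b : bool) (f : cplx R -> V) : cplx R -> V :=
  if b then dx f else dy f.
Arguments pd : simpl never.

Lemma line_self (V : Type) b (f : cplx R -> V) w : line b f w (coordc b w) = f w.
Proof. by case: b; rewrite /= /hline /Defs.vline cplx_eta. Qed.

Lemma pdE (V : normedModType R) b (f : cplx R -> V) w :
  pd b f w = derive1 (line b f w) (coordc b w).
Proof. by case: b. Qed.

Lemma near_line D b w : open D -> D w ->
  \forall t \near coordc b w, D (line b id w t).
Proof.
move=> oD Dw; have [e e0 eD] := open_box oD Dw.
apply: (nbhs_real_ball e0) => t te; apply: eD.
by case: b te; rewrite /= /hline /Defs.vline => te; split; rewrite //= subrr normr0.
Qed.

Lemma lineE (V : Type) b (f : cplx R -> V) w t : line b f w t = f (line b id w t).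
Proof. by case: b. Qed.

Lemma eq_near_line (V : Type) D b (f g : cplx R -> V) w : open D ->
  (forall v, D v -> f v = g v) -> D w ->
  \forall t \near coordc b w, line b f w t = line b g w t.
Proof.
move=> oD fg Dw; apply: filterS (near_line b oD Dw) => t Dt.
by rewrite lineE fg // -lineE.
Qed.

Section Ck.
Variable V : normedModType R.
Implicit Types f g : cplx R -> V.

Lemma eq_pd D b f g : open D -> (forall v, D v -> f v = g v) ->
  forall w, D w -> pd b f w = pd b g w.
Proof.
move=> oD fg w Dw; rewrite !pdE !derive1E; apply: near_eq_derive.
exact: eq_near_line fg Dw.
Qed.

Lemma CkP k D f : Ck_on k.+1 D f <->
  (forall w, D w -> {for w, continuous f}) /\
  forall b, (forall w, D w -> derivable (line b f w) (coordc b w) 1) /\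
            Ck_on k D (pd b f).
Proof.
split=> [[cf [h1 h2 h3 h4]]|[cf H]]; first by split => // -[].
by split => //; have [h1 h2] := H true; have [h3 h4] := H false.
Qed.

Lemma Ck_eq k D f g : open D -> (forall v, D v -> f v = g v) ->
  Ck_on k D f -> Ck_on k D g.
Proof.
move=> oD.
have cont f' g' : (forall v, D v -> f' v = g' v) ->
    (forall w, D w -> {for w, continuous f'}) ->
    forall w, D w -> {for w, continuous g'}.
  move=> fg cf w Dw; have := cf w Dw; rewrite /prop_for /continuous_at (fg _ Dw).
  apply: cvg_trans; apply: (@near_eq_cvg _ _ (nbhs w)).
  by apply: filterS (open_nbhs_nbhs (conj oD Dw)) => v; exact: fg.
elim: k f g => [|k IH] f g fg; first by move=> [cf _]; split => //; exact: cont cf.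
move=> /CkP[cf H]; apply/CkP; split; first exact: cont cf.
move=> b; have [df Cf] := H b; split; last first.
  by apply: IH Cf; exact: eq_pd.
move=> w Dw; apply: near_eq_derivable (df w Dw).
exact: eq_near_line fg Dw.
Qed.

Lemma CkS k D f : Ck_on k.+1 D f -> Ck_on k D f.
Proof.
elim: k f => [|k IH] f; first by move=> [].
move=> /CkP[cf H]; apply/CkP; split => // b; have [df Cf] := H b.
by split => //; apply: IH.
Qed.

Lemma Ck_cont k D f w : Ck_on k D f -> D w -> {for w, continuous f}.
Proof. by case: k => [|k] [cf _]; exact: cf. Qed.

End Ck.
End partial_derivatives.

Section real_valued.
Context {R : realType}.
Variable D : set (cplx R).
Hypothesis oD : open D.
Implicit Types (w : cplx R) (f g : cplx R -> R).

Definition Ckr k f := Ck_on k D (f : cplx R -> R^o).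
Definition smooth f := smooth_on D (f : cplx R -> R^o).
Definition pdr b f : cplx R -> R := pd b (f : cplx R -> R^o).
Arguments pdr : simpl never.

(** Existence and value of the derivative in one relation, so that the differentiation rules chain
    without separate differentiability conditions. *)
Definition has_pd b f w (l : R) := is_derive (coordc b w) (1 : R) (line b f w) l.

Lemma has_pdE b f w l : has_pd b f w l -> pdr b f w = l.
Proof. by move=> fl; rewrite /pdr pdE derive1E; exact: derive_val. Qed.

Lemma has_pdD b f g w k l : has_pd b f w k -> has_pd b g w l ->
  has_pd b (fun v => f v + g v) w (k + l).
Proof. by move=> fk gl; have := is_deriveD fk gl; case: b fk gl. Qed.

Lemma has_pdN b f w k : has_pd b f w k -> has_pd b (fun v => - f v) w (- k).
Proof. by move=> fk; have := is_deriveN fk; case: b fk. Qed.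

Lemma has_pdM b f g w k l : has_pd b f w k -> has_pd b g w l ->
  has_pd b (fun v => f v * g v) w (k * g w + f w * l).
Proof.
move=> fk gl; have := is_deriveM fk gl; rewrite !line_self.
have -> : f w *: l + g w *: k = k * g w + f w * l.
  by rewrite addrC; congr (_ + _); exact: mulrC.
by case: b fk gl.
Qed.

Lemma has_pdV b f w k : f w != 0 -> has_pd b f w k ->
  has_pd b (fun v => (f v)^-1) w (- k * ((f w)^-1 * (f w)^-1)).
Proof.
move=> f0 fk; have := is_deriveV _ fk; rewrite !line_self => /(_ f0).
have -> : - f w ^- 2 *: k = - k * ((f w)^-1 * (f w)^-1).
  by rewrite -invfM -expr2 mulNr mulrC -mulNr.
by case: b fk.
Qed.

Lemma has_pd_cst b (a : R) w : has_pd b (fun _ => a) w 0.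
Proof. by rewrite /has_pd; have := is_derive_cst a (coordc b w) 1; case: b. Qed.

Lemma Ckr_has_pd k b f w : Ckr k.+1 f -> D w -> has_pd b f w (pdr b f w).
Proof.
move=> /CkP[_ /(_ b)[df _]] Dw; rewrite /has_pd /pdr pdE derive1E.
exact/derivableP/df.
Qed.

Lemma CkrP k f : Ckr k.+1 f <->
  (forall w, D w -> {for w, continuous (f : cplx R -> R^o)}) /\
  forall b, (forall w, D w -> has_pd b f w (pdr b f w)) /\ Ckr k (pdr b f).
Proof.
split=> [Cf|[cf H]]; last first.
  by apply/CkP; split => // b; have [hf Cf] := H b; split => // w /hf[].
have [cf H] := (CkP _ _ _).1 Cf; split => // b; split; last by have [] := H b.
by move=> w; exact: Ckr_has_pd Cf.
Qed.

Lemma Ckr_eq k f g : (forall w, D w -> f w = g w) -> Ckr k f -> Ckr k g.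
Proof. by move=> fg; apply: Ck_eq. Qed.

Lemma Ckr_cst k (a : R) : Ckr k (fun _ => a).
Proof.
elim: k a => [|k IH] a; first by split => // w _; exact: cst_continuous.
apply/CkrP; split=> [w _|b]; first exact: cst_continuous.
split=> [w _|]; first by rewrite (has_pdE (has_pd_cst _ _ _)); exact: has_pd_cst.
by apply: Ckr_eq (IH 0) => w _; rewrite (has_pdE (has_pd_cst _ _ _)).
Qed.

Lemma CkrD k f g : Ckr k f -> Ckr k g -> Ckr k (fun w => f w + g w).
Proof.
elim: k f g => [|k IH] f g Cf Cg; (have cfg : forall w, D w ->
    {for w, continuous (fun v => f v + g v : R^o)} by
  move=> w Dw; exact: (cvgD (Ck_cont Cf Dw) (Ck_cont Cg Dw))); first by split.
apply/CkrP; split => // b.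
have pdfg w : D w -> has_pd b (fun v => f v + g v) w (pdr b f w + pdr b g w).
  by move=> Dw; exact: has_pdD (Ckr_has_pd b Cf Dw) (Ckr_has_pd b Cg Dw).
split=> [w Dw|]; first by rewrite (has_pdE (pdfg _ Dw)); exact: pdfg.
have [_ /(_ b)[_ Cf']] := (CkrP _ _).1 Cf; have [_ /(_ b)[_ Cg']] := (CkrP _ _).1 Cg.
by apply: Ckr_eq (IH _ _ Cf' Cg') => w Dw; rewrite (has_pdE (pdfg _ Dw)).
Qed.

Lemma CkrN k f : Ckr k f -> Ckr k (fun w => - f w).
Proof.
elim: k f => [|k IH] f Cf; (have cf : forall w, D w ->
    {for w, continuous (fun v => - f v : R^o)} by
  move=> w Dw; exact: (cvgN (Ck_cont Cf Dw))); first by split.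
apply/CkrP; split => // b.
have pdf w : D w -> has_pd b (fun v => - f v) w (- pdr b f w).
  by move=> Dw; exact: has_pdN (Ckr_has_pd b Cf Dw).
split=> [w Dw|]; first by rewrite (has_pdE (pdf _ Dw)); exact: pdf.
have [_ /(_ b)[_ Cf']] := (CkrP _ _).1 Cf.
by apply: Ckr_eq (IH _ Cf') => w Dw; rewrite (has_pdE (pdf _ Dw)).
Qed.

Lemma CkrM k f g : Ckr k f -> Ckr k g -> Ckr k (fun w => f w * g w).
Proof.
elim: k f g => [|k IH] f g Cf Cg; (have cfg : forall w, D w ->
    {for w, continuous (fun v => f v * g v : R^o)} by
  move=> w Dw; exact: (cvgM (Ck_cont Cf Dw) (Ck_cont Cg Dw))); first by split.
apply/CkrP; split => // b.
have pdfg w : D w -> has_pd b (fun v => f v * g v) w (pdr b f w * g w + f w * pdr b g w).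
  by move=> Dw; exact: has_pdM (Ckr_has_pd b Cf Dw) (Ckr_has_pd b Cg Dw).
split=> [w Dw|]; first by rewrite (has_pdE (pdfg _ Dw)); exact: pdfg.
have [_ /(_ b)[_ Cf']] := (CkrP _ _).1 Cf; have [_ /(_ b)[_ Cg']] := (CkrP _ _).1 Cg.
apply: Ckr_eq (CkrD (IH _ _ Cf' (CkS Cg)) (IH _ _ (CkS Cf) Cg')) => w Dw.
by rewrite (has_pdE (pdfg _ Dw)).
Qed.

Lemma CkrV k f : (forall w, D w -> f w != 0) -> Ckr k f -> Ckr k (fun w => (f w)^-1).
Proof.
move=> f0; elim: k => [|k IH] Cf; (have cf : forall w, D w ->
    {for w, continuous (fun v => (f v)^-1 : R^o)} by
  move=> w Dw; exact: (cvgV (f0 _ Dw) (Ck_cont Cf Dw))); first by split.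
apply/CkrP; split => // b.
have pdf w : D w -> has_pd b (fun v => (f v)^-1) w (- pdr b f w * ((f w)^-1 * (f w)^-1)).
  by move=> Dw; exact: has_pdV (f0 _ Dw) (Ckr_has_pd b Cf Dw).
split=> [w Dw|]; first by rewrite (has_pdE (pdf _ Dw)); exact: pdf.
have [_ /(_ b)[_ Cf']] := (CkrP _ _).1 Cf.
have CV := IH (CkS Cf).
apply: Ckr_eq (CkrM (CkrN Cf') (CkrM CV CV)) => w Dw.
by rewrite (has_pdE (pdf _ Dw)).
Qed.

Lemma smooth_cst (a : R) : smooth (fun _ => a).
Proof. by move=> k; exact: Ckr_cst. Qed.
Lemma smoothD f g : smooth f -> smooth g -> smooth (fun w => f w + g w).
Proof. by move=> sf sg k; exact: CkrD (sf k) (sg k). Qed.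
Lemma smoothN f : smooth f -> smooth (fun w => - f w).
Proof. by move=> sf k; exact: CkrN (sf k). Qed.
Lemma smoothB f g : smooth f -> smooth g -> smooth (fun w => f w - g w).
Proof. by move=> sf sg; exact: smoothD sf (smoothN sg). Qed.
Lemma smoothM f g : smooth f -> smooth g -> smooth (fun w => f w * g w).
Proof. by move=> sf sg k; exact: CkrM (sf k) (sg k). Qed.
Lemma smoothV f : (forall w, D w -> f w != 0) -> smooth f -> smooth (fun w => (f w)^-1).
Proof. by move=> f0 sf k; exact: CkrV f0 (sf k). Qed.
Lemma smooth_eq f g : (forall w, D w -> f w = g w) -> smooth f -> smooth g.
Proof. by move=> fg sf k; exact: Ckr_eq fg (sf k). Qed.
Lemma smooth_pd b f : smooth f -> smooth (pdr b f).
Proof. by move=> sf k; have [_ /(_ b)[]] := (CkrP _ _).1 (sf k.+1). Qed.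
Lemma smooth_has_pd b f w : smooth f -> D w -> has_pd b f w (pdr b f w).
Proof. by move=> sf; exact: Ckr_has_pd (sf 1%N). Qed.

Lemma pdr_eq b f g w : (forall w, D w -> f w = g w) -> D w -> pdr b f w = pdr b g w.
Proof. by move=> fg Dw; exact: (eq_pd b oD fg Dw). Qed.
Lemma pdr_cst b (a : R) w : pdr b (fun _ => a) w = 0.
Proof. exact: has_pdE (has_pd_cst _ _ _). Qed.
Lemma pdrD b f g w : smooth f -> smooth g -> D w ->
  pdr b (fun w => f w + g w) w = pdr b f w + pdr b g w.
Proof. by move=> sf sg Dw; apply: has_pdE; apply: has_pdD; exact: smooth_has_pd. Qed.
Lemma pdrN b f w : smooth f -> D w -> pdr b (fun w => - f w) w = - pdr b f w.
Proof. by move=> sf Dw; apply: has_pdE; apply: has_pdN; exact: smooth_has_pd. Qed.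
Lemma pdrM b f g w : smooth f -> smooth g -> D w ->
  pdr b (fun w => f w * g w) w = pdr b f w * g w + f w * pdr b g w.
Proof. by move=> sf sg Dw; apply: has_pdE; apply: has_pdM; exact: smooth_has_pd. Qed.

End real_valued.

(** * Mean value theorems in one and two variables *)

Section mean_value.
Context {R : realType}.

Lemma MVT_closed (f df : R -> R) (a b : R) : a < b ->
  (forall x, a <= x <= b -> is_derive x (1 : R) f (df x)) ->
  exists2 c, a <= c <= b & f b - f a = df c * (b - a).
Proof.
move=> ab df_f.
have dfo x : x \in `]a, b[ -> is_derive x (1 : R) f (df x).
  by rewrite in_itv /= => /andP[/ltW ax /ltW xb]; apply: df_f; rewrite ax.
have fc : {within `[a, b], continuous f}.
  apply: derivable_within_continuous => x; rewrite in_itv /= => xab.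
  by have [] := df_f x xab.
have [c cab eqc] := MVT ab dfo fc; exists c => //.
by have := cab; rewrite in_itv /= => /andP[/ltW -> /ltW ->].
Qed.

Lemma zero_derive_eq (f : R -> R) (c e x y : R) :
  (forall t, `|t - c| < e -> is_derive t (1 : R) f 0) ->
  `|x - c| < e -> `|y - c| < e -> f x = f y.
Proof.
move=> df; wlog xy : x y / x <= y => [H xc yc|].
  by have [xy|/ltW yx] := leP x y; [|apply/esym]; exact: H.
rewrite !ltr_norml => /andP[x1 x2] /andP[y1 y2].
move: xy; rewrite le_eqVlt => /orP[/eqP -> //|xy].
have [t /andP[xt ty]|t _] := @MVT_closed f (fun _ => 0) x y xy.
  by apply: df; rewrite ltr_norml; apply/andP; split; lra.
by rewrite mul0r => /eqP; rewrite subr_eq0 => /eqP.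
Qed.

(** The mean value theorem is applied in the first variable, then in the second. Since the second
    difference is symmetric in the two variables, either order of differentiation can be reached. *)
Lemma mixed_difference (g gx gxy : R -> R -> R) (x y h : R) : 0 < h ->
  (forall s t, x <= s <= x + h -> y <= t <= y + h ->
     is_derive s (1 : R) (g^~ t) (gx s t) /\ is_derive t (1 : R) (gx s) (gxy s t)) ->
  exists s t, [/\ x <= s <= x + h, y <= t <= y + h &
    g (x + h) (y + h) - g (x + h) y - (g x (y + h) - g x y) = gxy s t * (h * h)].
Proof.
move=> h0 dg; have ltxh : x < x + h by rewrite ltrDl.
have ltyh : y < y + h by rewrite ltrDl.
have [|s sx es] := @MVT_closed (fun s => g s (y + h) - g s y)
    (fun s => gx s (y + h) - gx s y) _ _ ltxh.
  move=> s sx; apply: is_deriveB.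
    by have [] := dg s (y + h) sx; rewrite ?lexx ?ltW.
  by have [] := dg s y sx; rewrite ?lexx ?ltW.
have [|t ty et] := @MVT_closed (gx s) (gxy s) _ _ ltyh.
  by move=> t ty; have [] := dg s t sx ty.
exists s, t; split => //.
have -> : g (x + h) (y + h) - g (x + h) y - (g x (y + h) - g x y) =
  (gx s (y + h) - gx s y) * (x + h - x) by rewrite -es; ring.
by rewrite et; ring.
Qed.

End mean_value.

(** * Symmetry of second derivatives and functions with zero gradient *)

Section two_variables.
Context {R : realType}.
Variable D : set (cplx R).
Hypothesis oD : open D.
Implicit Types (w : cplx R) (f g : cplx R -> R).

Local Notation smooth := (smooth D).

Lemma smooth_near f w (e : R) : smooth f -> D w -> 0 < e ->
  exists2 d : R, 0 < d & forall v, box w d v -> `|f v - f w| < e.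
Proof.
move=> sf Dw e0; have := Ck_cont (sf 0%N) Dw.
move=> /cvgrPdist_lt /(_ _ e0) /nbhs_box[d d0 dP]; exists d => // v /dP.
by rewrite distrC.
Qed.

(** The second difference over a square of side h is h^2 times either mixed derivative at some point
    of the square. Continuity of both at w then makes their values at w agree. *)
Lemma pdr_comm f w : smooth f -> D w ->
  pdr true (pdr false f) w = pdr false (pdr true f) w.
Proof.
move=> sf Dw; apply/eqP; rewrite -subr_eq0 -normr_le0; apply/ler_addgt0Pl => e e0.
rewrite addr0; have e2 : 0 < e / 2 by rewrite divr_gt0.
have sfx := smooth_pd true sf; have sfy := smooth_pd false sf.
have [d1 d10 H1] := smooth_near (smooth_pd true sfy) Dw e2.
have [d2 d20 H2] := smooth_near (smooth_pd false sfx) Dw e2.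
have [d3 d30 H3] := open_box oD Dw.
set A := pdr true _ w; set B := pdr false _ w.
pose h := Num.min d1 (Num.min d2 d3) / 2.
have h0 : 0 < h by rewrite divr_gt0 // !lt_min d10 d20.
have [hd1 hd2 hd3] : [/\ h < d1, h < d2 & h < d3].
  have hm : h < Num.min d1 (Num.min d2 d3).
    by rewrite ltr_pdivrMr // ltr_pMr ?ltr1n // !lt_min d10 d20.
  by move: hm; rewrite !lt_min => /and3P[].
case: w => [x y] in Dw H1 H2 H3 A B *.
have bx (d s t : R) : h < d -> x <= s <= x + h -> y <= t <= y + h -> box (x +i* y) d (s +i* t).
  move=> hd /andP[? ?] /andP[? ?]; split => /=; rewrite ger0_norm; lra.
have [|s [t [sx ty est]]] := @mixed_difference _ (fun s t => f (s +i* t))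
    (fun s t => pdr true f (s +i* t)) (fun s t => pdr false (pdr true f) (s +i* t)) x y h h0.
  move=> s t sx ty; have Dst := H3 _ (bx _ _ _ hd3 sx ty).
  by split; [exact: (smooth_has_pd true sf Dst)|exact: (smooth_has_pd false sfx Dst)].
have [|t' [s' [ty' sx' est']]] := @mixed_difference _ (fun t s => f (s +i* t))
    (fun t s => pdr false f (s +i* t)) (fun t s => pdr true (pdr false f) (s +i* t)) y x h h0.
  move=> t' s' ty' sx'; have Dst := H3 _ (bx _ _ _ hd3 sx' ty').
  by split; [exact: (smooth_has_pd false sf Dst)|exact: (smooth_has_pd true sfy Dst)].
have eqm : pdr false (pdr true f) (s +i* t) = pdr true (pdr false f) (s' +i* t').
  have hh : h * h != 0 by rewrite mulf_neq0 ?gt_eqF.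
  have swap (x1 x2 x3 x4 : R) : x1 - x2 - (x3 - x4) = x1 - x3 - (x2 - x4) by ring.
  exact: mulIf hh _ _ (etrans (esym est) (etrans (swap _ _ _ _) est')).
have := H1 _ (bx _ _ _ hd1 sx' ty'); have := H2 _ (bx _ _ _ hd2 sx ty).
rewrite eqm -/A -/B; move: A B (pdr true _ _) => {eqm est est'} A B C; rewrite !ltr_norml ler_norml => /andP[? ?] /andP[? ?]; apply/andP; split; lra.
Qed.

Lemma eq_vertical f w (e : R) : smooth f -> box w e `<=` D ->
  (forall v, box w e v -> pdr false f v = 0) ->
  forall s t t', box w e (s +i* t) -> box w e (s +i* t') -> f (s +i* t) = f (s +i* t').
Proof.
move=> sf eD f0 s t t' [ws wt] [_ wt'].
apply: (@zero_derive_eq _ (fun t => f (s +i* t)) (complex.Im w) e) => // u wu.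
have wsu : box w e (s +i* u) by split.
by rewrite -(f0 _ wsu); exact: (smooth_has_pd false sf (eD _ wsu)).
Qed.

Lemma eq_horizontal f w (e : R) : smooth f -> box w e `<=` D ->
  (forall v, box w e v -> pdr true f v = 0) ->
  forall s s' t, box w e (s +i* t) -> box w e (s' +i* t) -> f (s +i* t) = f (s' +i* t).
Proof.
move=> sf eD f0 s s' t [ws wt] [ws' _].
apply: (@zero_derive_eq _ (fun s => f (s +i* t)) (complex.Re w) e) => // u wu.
have wsu : box w e (u +i* t) by split.
by rewrite -(f0 _ wsu); exact: (smooth_has_pd true sf (eD _ wsu)).
Qed.

(** A zero gradient makes f locally constant, along a vertical and then a horizontal segment of a
    box. The level sets are therefore open and closed in D. *)
Lemma connected_cst f : smooth f -> connected D ->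
  (forall v, D v -> pdr true f v = 0) ->
  (forall v, D v -> pdr false f v = 0) ->
  exists a : R, forall v, D v -> f v = a.
Proof.
move=> sf cD fx fy; have [D0|/set0P[w0 Dw0]] := eqVneq D set0.
  by exists 0 => v; rewrite D0.
exists (f w0).
have loc w : D w -> \forall v \near w, D v /\ f v = f w.
  move=> Dw; have [e e0 eD] := open_box oD Dw; apply/nbhs_box; exists e => // v ev.
  split; first exact: eD.
  case: v w ev {Dw} eD => [s t] [x y] [/= sx ty] eD.
  have bsy : box (x +i* y) e (s +i* y) by split => //=; rewrite subrr normr0.
  rewrite (eq_vertical sf eD (fun v ev => fy _ (eD _ ev)) _ bsy) //.
  by apply: (eq_horizontal sf eD (fun v ev => fx _ (eD _ ev)) bsy); exact: box_self.
have openP (P : set R) : open (D `&` [set v | P (f v)]).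
  rewrite openE => w [Dw Pw]; apply: filterS (loc _ Dw) => v [Dv fv].
  by split => //=; rewrite fv.
suff eD : D `&` [set v | f v = f w0] = D by move=> v; rewrite -{1}eD => -[].
apply: cD; first by exists w0.
- exists (D `&` [set v | f v = f w0]); first exact: (openP (fun x => x = f w0)).
  by rewrite setIA setIid.
- exists (~` (D `&` [set v | f v <> f w0])).
    by apply: open_closedC; exact: (openP (fun x => x <> f w0)).
  apply/seteqP; split => v /= [Dv fv]; split => //; first by case.
  by apply: contrapT => fv'; apply: fv.
Qed.

End two_variables.

(** * Vector-valued maps and the ambient bilinear form *)

Section vector_valued.
Context {R : realType}.
Variable D : set (cplx R).
Hypothesis oD : open D.
Implicit Types (w : cplx R) (F G : cplx R -> 'rV[R]_4).

Local Notation smooth := (smooth D).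

Definition entry i F : cplx R -> R := fun w => F w ord0 i.

Lemma smooth_on_pd (V : normedModType R) b (F : cplx R -> V) :
  smooth_on D F -> smooth_on D (pd b F).
Proof. by move=> sF k; have [_ /(_ b)[]] := (CkP _ _ _).1 (sF k.+1). Qed.

Lemma pd_entry k b F i w : Ck_on k.+1 D F -> D w ->
  pdr b (entry i F) w = entry i (pd b F) w.
Proof.
move=> /CkP[_ /(_ b)[dF _]] Dw; have dFw := dF w Dw.
rewrite /pdr /entry !pdE !derive1E (derive_mx dFw) mxE.
by case: b {dF dFw}.
Qed.

Lemma Ck_entry k F i : Ck_on k D F -> Ckr D k (entry i F).
Proof.
elim: k F => [|k IH] F CF; (have cF : forall w, D w ->
    {for w, continuous (entry i F : cplx R -> R^o)} by
  move=> w Dw; exact: (@continuous_comp _ _ _ F (fun M : 'rV[R]_4 => M ord0 i) w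
    (Ck_cont CF Dw) (@coord_continuous _ _ _ ord0 i (F w))));
  first by split.
apply/CkP; split=> // b; have [_ /(_ b)[dF CpF]] := (CkP _ _ _).1 CF; split.
  move=> w Dw; have /derivable_mxP /(_ ord0 i) := dF w Dw.
  by case: b {dF CpF}.
apply: (Ckr_eq oD) (IH _ CpF) => w Dw.
exact/esym/(pd_entry b i CF Dw).
Qed.

Lemma smooth_entry F i : smooth_on D F -> smooth (entry i F).
Proof. by move=> sF k; exact: Ck_entry. Qed.

Lemma pdr_entry b F i w : smooth_on D F -> D w ->
  pdr b (entry i F) w = entry i (pd b F) w.
Proof. by move=> sF; exact: pd_entry (sF 1%N). Qed.

Lemma pd_comm F w : smooth_on D F -> D w ->
  pd true (pd false F) w = pd false (pd true F) w.
Proof.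
move=> sF Dw; apply/rowP => i.
have H1 := pdr_entry true i (smooth_on_pd false sF) Dw.
have H2 := pdr_entry false i (smooth_on_pd true sF) Dw.
have H3 : pdr true (entry i (pd false F)) w = pdr true (pdr false (entry i F)) w.
  by apply: (pdr_eq oD true) => // v Dv; rewrite pdr_entry.
have H4 : pdr false (entry i (pd true F)) w = pdr false (pdr true (entry i F)) w.
  by apply: (pdr_eq oD false) => // v Dv; rewrite pdr_entry.
have H5 := pdr_comm oD (smooth_entry i sF) Dw.
exact: (etrans (esym H1) (etrans H3 (etrans H5 (etrans (esym H4) H2)))).
Qed.

Lemma smooth_sum (I : Type) (s : seq I) (f : I -> cplx R -> R) :
  (forall i, smooth (f i)) -> smooth (fun w => \sum_(i <- s) f i w).
Proof.
move=> sf; elim: s => [|i s IH].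
  by apply: (smooth_eq oD) (smooth_cst oD 0) => w _; rewrite big_nil.
by apply: (smooth_eq oD) (smoothD oD (sf i) IH) => w _; rewrite big_cons.
Qed.

Lemma pdr_sum (I : Type) (s : seq I) b (f : I -> cplx R -> R) w :
  (forall i, smooth (f i)) -> D w ->
  pdr b (fun w => \sum_(i <- s) f i w) w = \sum_(i <- s) pdr b (f i) w.
Proof.
move=> sf Dw; elim: s => [|i s IH].
  rewrite big_nil -[RHS](pdr_cst b 0 w).
  by apply: (pdr_eq oD b) => // v _; rewrite big_nil.
rewrite big_cons -IH -(pdrD _ _ _ Dw) //; last exact: smooth_sum.
by apply: (pdr_eq oD b) => // v _; rewrite big_cons.
Qed.

Definition amb_sign (c : R) (i : 'I_4) : R := if (c < 0) && (i == ord0) then -1 else 1.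

Lemma smooth_ambient (c : R) F G : smooth_on D F -> smooth_on D G ->
  smooth (fun w => ambient c (F w) (G w)).
Proof.
move=> sF sG; apply: smooth_sum => i.
apply: (smoothM oD (smoothM oD _ _)); [exact: smooth_cst|exact: smooth_entry..].
Qed.

Lemma pdr_ambient (c : R) b F G w : smooth_on D F -> smooth_on D G -> D w ->
  pdr b (fun w => ambient c (F w) (G w)) w =
  ambient c (pd b F w) (G w) + ambient c (F w) (pd b G w).
Proof.
move=> sF sG Dw; have sFi i := smooth_entry i sF; have sGi i := smooth_entry i sG.
have sc i := smooth_cst oD (amb_sign c i).
have scF i := smoothM oD (sc i) (sFi i).
rewrite /ambient (pdr_sum _ _ (f := fun i w => amb_sign c i * entry i F w * entry i G w)) //.
  rewrite -big_split /=; apply: eq_bigr => i _.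
  rewrite (pdrM _ (scF i) (sGi i) Dw) (pdrM _ (sc i) (sFi i) Dw) pdr_cst !pdr_entry //.
  by rewrite mul0r add0r.
by move=> i; apply: smoothM.
Qed.

Lemma ambientC (c : R) (u v : 'rV[R]_4) : ambient c u v = ambient c v u.
Proof. by apply: eq_bigr => i _; rewrite mulrAC. Qed.

End vector_valued.

(* Four mutually orthogonal non-null vectors form a basis. *)
Lemma parseval (R : realType) (c : R) (e : 'I_4 -> 'rV[R]_4) :
  (forall i, ambient c (e i) (e i) != 0) ->
  (forall i j, i != j -> ambient c (e i) (e j) = 0) ->
  forall u v, ambient c u v =
    \sum_i ambient c u (e i) * ambient c v (e i) / ambient c (e i) (e i).
Proof.
move=> e0 eo.
pose J : 'M[R]_4 := diag_mx (\row_i amb_sign c i).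
have ambE u v : ambient c u v = (u *m J *m v^T) ord0 ord0.
  by rewrite mxE; apply: eq_bigr => i _; rewrite mul_mx_diag !mxE [amb_sign _ _ * _]mulrC.
pose E : 'M[R]_4 := \matrix_i e i.
pose n : 'rV[R]_4 := \row_i ambient c (e i) (e i).
have EJE : E *m J *m E^T = diag_mx n.
  apply/matrixP => i j; have -> : (E *m J *m E^T) i j = ambient c (e i) (e j).
    by rewrite mul_mx_diag mxE; apply: eq_bigr => k _; rewrite !mxE [amb_sign _ _ * _]mulrC.
  by rewrite !mxE; case: eqVneq => [<-|ij]; [rewrite mulr1n|rewrite mulr0n eo].
pose n1 : 'rV[R]_4 := \row_i (ambient c (e i) (e i))^-1.
have nn1 : diag_mx n *m diag_mx n1 = 1%:M.
  rewrite mulmx_diag -diag_const_mx; congr diag_mx; apply/rowP => i.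
  by rewrite !mxE mulfV.
(* Orthogonality makes E J a left inverse of E^T n^-1. For square matrices it is also a right
   inverse, which is the completeness of the system. *)
have inv : E^T *m diag_mx n1 *m E *m J = 1%:M.
  have : (E *m J) *m (E^T *m diag_mx n1) = 1%:M by rewrite mulmxA EJE.
  by move/mulmx1C; rewrite mulmxA.
move=> u v.
have -> : ambient c u v = (u *m J *m E^T *m diag_mx n1 *m (v *m J *m E^T)^T) ord0 ord0.
  have -> : u *m J *m E^T *m diag_mx n1 *m (v *m J *m E^T)^T =
    u *m J *m (E^T *m diag_mx n1 *m E *m J) *m v^T.
    by rewrite !trmx_mul trmxK tr_diag_mx !mulmxA.
  by rewrite inv mulmx1 ambE.
rewrite mxE; apply: eq_bigr => i _.
have ue x : (x *m J *m E^T) ord0 i = ambient c x (e i).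
  by rewrite mul_mx_diag mxE; apply: eq_bigr => k _; rewrite !mxE [amb_sign _ _ * _]mulrC.
by rewrite mul_mx_diag mxE ue [n1 _ _]mxE [_^T _ _]mxE ue mulrAC.
Qed.

(** * The Gauss and Codazzi equations in a space form *)

(* The values at one point of the frame (X, Y, N, n) along a conformal
   immersion and of its derivatives: [n] is normal to the space form, that is,
   the position vector if [c != 0] ([tau = 1], [nu = c^-1]) and the first basis
   vector if [c = 0] ([tau = 0], [nu = 1]). *)
Record conformal_frame (R : realType) (c : R) (X Y N n xx xy yy Nx Ny : 'rV[R]_4)
    (l lx ly tau nu : R) : Prop := ConformalFrame {
  frame_gt0 : 0 < l;
  frame_nu : nu != 0;
  frame_tau : tau ^+ 2 = c * nu;
  frame_XX : ambient c X X = l;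
  frame_XY : ambient c X Y = 0;
  frame_YY : ambient c Y Y = l;
  frame_NN : ambient c N N = 1;
  frame_NX : ambient c N X = 0;
  frame_NY : ambient c N Y = 0;
  frame_nn : ambient c n n = nu;
  frame_nX : ambient c n X = 0;
  frame_nY : ambient c n Y = 0;
  frame_nN : ambient c n N = 0;
  frame_dx_XX : ambient c xx X + ambient c X xx = lx;
  frame_dy_XX : ambient c xy X + ambient c X xy = ly;
  frame_dx_XY : ambient c xx Y + ambient c X xy = 0;
  frame_dy_XY : ambient c xy Y + ambient c X yy = 0;
  frame_dx_YY : ambient c xy Y + ambient c Y xy = lx;
  frame_dy_YY : ambient c yy Y + ambient c Y yy = ly;
  frame_dx_nX : ambient c (tau *: X) X + ambient c n xx = 0;
  frame_dy_nX : ambient c (tau *: Y) X + ambient c n xy = 0;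
  frame_dy_nY : ambient c (tau *: Y) Y + ambient c n yy = 0;
  frame_dx_NX : ambient c Nx X + ambient c N xx = 0;
  frame_dx_NY : ambient c Nx Y + ambient c N xy = 0;
  frame_dy_NX : ambient c Ny X + ambient c N xy = 0;
  frame_dy_NY : ambient c Ny Y + ambient c N yy = 0;
  frame_dx_NN : ambient c Nx N + ambient c N Nx = 0;
  frame_dy_NN : ambient c Ny N + ambient c N Ny = 0;
  frame_dx_nN : ambient c (tau *: X) N + ambient c n Nx = 0;
  frame_dy_nN : ambient c (tau *: Y) N + ambient c n Ny = 0 }.

Lemma ambientZl (R : realType) (c a : R) (u v : 'rV[R]_4) :
  ambient c (a *: u) v = a * ambient c u v.
Proof. by rewrite /ambient mulr_sumr; apply: eq_bigr => i _; rewrite !mxE; ring. Qed.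

Section frame_equations.
Context {R : realType}.
Variables (c : R) (X Y N n xx xy yy Nx Ny : 'rV[R]_4) (l lx ly tau nu : R).
Hypothesis F : conformal_frame c X Y N n xx xy yy Nx Ny l lx ly tau nu.

Local Notation amb := (ambient c).

Let l_neq0 : l != 0. Proof. by rewrite gt_eqF // (frame_gt0 F). Qed.

Lemma frame_parseval u v : amb u v =
  amb u X * amb v X / l + amb u Y * amb v Y / l +
  amb u N * amb v N + amb u n * amb v n / nu.
Proof.
case: F => _ nu0 _ XX XY YY NN NX NY nn nX nY nN *.
pose e (i : 'I_4) := [:: X; Y; N; n]`_i.
rewrite (@parseval _ c e) => [|i|i j].
- by rewrite !big_ord_recl big_ord0 /e /= XX YY NN nn divr1 addr0 !addrA.
- case: i => [[|[|[|[|i]]]] Hi] //; rewrite /e /= ?XX ?YY ?NN ?nn //.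
- case: i j => [[|[|[|[|i]]]] Hi] [[|[|[|[|j]]]] Hj] // _; rewrite /e /=.
  all: by first [rewrite XY|rewrite nX|rewrite nY|rewrite NX|rewrite NY|rewrite nN|
    rewrite ambientC ?XY ?nX ?nY ?NX ?NY ?nN].
Qed.

Let xxX : amb xx X = lx / 2.
Proof. by have := frame_dx_XX F; rewrite [amb X _]ambientC; lra. Qed.
Let xyX : amb xy X = ly / 2.
Proof. by have := frame_dy_XX F; rewrite [amb X _]ambientC; lra. Qed.
Lemma frame_xxY : amb xx Y = - ly / 2.
Proof. by have := frame_dx_XY F; rewrite [amb X _]ambientC xyX; lra. Qed.
Lemma frame_xyY : amb xy Y = lx / 2.
Proof. by have := frame_dx_YY F; rewrite [amb Y _]ambientC; lra. Qed.
Let yyX : amb yy X = - lx / 2.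
Proof. by have := frame_dy_XY F; rewrite [amb X _]ambientC frame_xyY; lra. Qed.
Let yyY : amb yy Y = ly / 2.
Proof. by have := frame_dy_YY F; rewrite [amb Y _]ambientC; lra. Qed.
Let xxn : amb xx n = - tau * l.
Proof. by have := frame_dx_nX F; rewrite ambientZl (frame_XX F) [amb n _]ambientC; lra. Qed.
Let xyn : amb xy n = 0.
Proof.
have := frame_dy_nX F; rewrite ambientZl [amb Y _]ambientC (frame_XY F).
by rewrite [amb n _]ambientC mulr0 add0r.
Qed.
Let yyn : amb yy n = - tau * l.
Proof. by have := frame_dy_nY F; rewrite ambientZl (frame_YY F) [amb n _]ambientC; lra. Qed.
Let NxX : amb Nx X = - amb xx N.
Proof. by have := frame_dx_NX F; rewrite [amb N _]ambientC; lra. Qed.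
Let NxY : amb Nx Y = - amb xy N.
Proof. by have := frame_dx_NY F; rewrite [amb N _]ambientC; lra. Qed.
Let NyX : amb Ny X = - amb xy N.
Proof. by have := frame_dy_NX F; rewrite [amb N _]ambientC; lra. Qed.
Let NyY : amb Ny Y = - amb yy N.
Proof. by have := frame_dy_NY F; rewrite [amb N _]ambientC; lra. Qed.
Let NxN : amb Nx N = 0.
Proof. by have := frame_dx_NN F; rewrite [amb N _]ambientC; lra. Qed.
Let NyN : amb Ny N = 0.
Proof. by have := frame_dy_NN F; rewrite [amb N _]ambientC; lra. Qed.
Let Nxn : amb Nx n = 0.
Proof.
have := frame_dx_nN F; rewrite ambientZl [amb X N]ambientC (frame_NX F).
by rewrite [amb n _]ambientC mulr0 add0r.
Qed.
Let Nyn : amb Ny n = 0.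
Proof.
have := frame_dy_nN F; rewrite ambientZl [amb Y N]ambientC (frame_NY F).
by rewrite [amb n _]ambientC mulr0 add0r.
Qed.

(** The left side is what remains of (h11)_y - (h12)_x once the third derivatives of r cancel; it is
    evaluated in the frame. *)
Lemma frame_codazzi1 : amb xx Ny - amb xy Nx = ly * (amb xx N + amb yy N) / (2 * l).
Proof.
rewrite (frame_parseval xx) (frame_parseval xy).
rewrite xxX frame_xxY xxn xyX frame_xyY xyn NxX NxY NxN Nxn NyX NyY NyN Nyn.
by field; rewrite l_neq0 (frame_nu F).
Qed.

Lemma frame_codazzi2 : amb yy Nx - amb xy Ny = lx * (amb xx N + amb yy N) / (2 * l).
Proof.
rewrite (frame_parseval yy) (frame_parseval xy).
rewrite yyX yyY yyn xyX frame_xyY xyn NxX NxY NxN Nxn NyX NyY NyN Nyn.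
by field; rewrite l_neq0 (frame_nu F).
Qed.

(** The component along [n] contributes tau^2 l^2 / nu = c l^2: this is how the curvature of the
    space form enters a computation in flat space. *)
Lemma frame_gauss : amb xx yy - amb xy xy =
  amb xx N * amb yy N - amb xy N ^+ 2 - (lx ^+ 2 + ly ^+ 2) / (2 * l) + c * l ^+ 2.
Proof.
rewrite (frame_parseval xx) (frame_parseval xy).
rewrite yyX yyY yyn xyX frame_xyY xyn xxX frame_xxY xxn.
have -> : c = tau ^+ 2 / nu by rewrite (frame_tau F) mulfK // (frame_nu F).
by field; rewrite l_neq0 (frame_nu F).
Qed.

End frame_equations.

(** Here a = <r_xxy, r_y>, b = <r_xx, r_yy> and d = <r_xy, r_xy>. The third derivative cancels
    between the first two equations, leaving b - d = - (l_xx + l_yy) / 2. *)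
Lemma gauss_arith (R : realFieldType) (h11 h12 h22 lxx lyy lx ly a b d L C : R) :
  a + b = - lyy * 2^-1 + - ly * 0 -> a + d = lxx * 2^-1 + lx * 0 ->
  b - d = h11 * h22 - h12 ^+ 2 - (lx ^+ 2 + ly ^+ 2) / (2 * L) + C * L ^+ 2 ->
  h11 * h22 - h12 ^+ 2 =
  - (lxx + lyy) / 2 + (lx ^+ 2 + ly ^+ 2) / (2 * L) - C * L ^+ 2.
Proof.
move=> q1 q2 q3; have -> : - (lxx + lyy) / 2 = b - d by lra.
by rewrite q3; ring.
Qed.

Section gauss_codazzi.
Context {R : realType}.
Variables (D : set (cplx R)) (c : R) (r N n : cplx R -> 'rV[R]_4).
Variables (l : cplx R -> R) (tau nu : R).
Hypothesis oD : open D.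
Hypotheses (sr : smooth_on D r) (sN : smooth_on D N) (sn : smooth_on D n).
Hypothesis sl : smooth D l.
Hypothesis l_gt0 : forall w, D w -> 0 < l w.
Local Notation amb := (ambient c).
Local Notation rx := (pd true r).
Local Notation ry := (pd false r).
Hypothesis rxx : forall w, D w -> amb (rx w) (rx w) = l w.
Hypothesis rxy : forall w, D w -> amb (rx w) (ry w) = 0.
Hypothesis ryy : forall w, D w -> amb (ry w) (ry w) = l w.
Hypothesis NN : forall w, D w -> amb (N w) (N w) = 1.
Hypothesis Nr : forall b w, D w -> amb (N w) (pd b r w) = 0.
Hypothesis nn : forall w, D w -> amb (n w) (n w) = nu.
Hypothesis nr : forall b w, D w -> amb (n w) (pd b r w) = 0.
Hypothesis nN : forall w, D w -> amb (n w) (N w) = 0.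
Hypothesis dn : forall b w, D w -> pd b n w = tau *: pd b r w.
Hypothesis nu_neq0 : nu != 0.
Hypothesis tau_nu : tau ^+ 2 = c * nu.

Let srb b : smooth_on D (pd b r) := smooth_on_pd b sr.
Let srbb b b' : smooth_on D (pd b (pd b' r)) := smooth_on_pd b (srb b').

Let diff_ambient b F G k w : smooth_on D F -> smooth_on D G ->
  (forall v, D v -> amb (F v) (G v) = k v) -> D w ->
  amb (pd b F w) (G w) + amb (F w) (pd b G w) = pdr b k w.
Proof.
move=> sF sG Hk Dw; rewrite -(pdr_ambient oD c b sF sG Dw).
exact: (pdr_eq oD b Hk Dw).
Qed.

Let rcomm w : D w -> pd false (pd true r) w = pd true (pd false r) w.
Proof. by move=> Dw; rewrite (pd_comm oD sr Dw). Qed.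

Lemma immersion_frame w : D w -> conformal_frame c (rx w) (ry w) (N w) (n w)
  (pd true rx w) (pd true ry w) (pd false ry w) (pd true N w) (pd false N w)
  (l w) (pdr true l w) (pdr false l w) tau nu.
Proof.
move=> Dw; have cm := rcomm Dw; have d0 b := pdr_cst b (0 : R) w.
have dNr b b' := diff_ambient b sN (srb b') (Nr b') Dw.
have dnr b b' := diff_ambient b sn (srb b') (nr b') Dw.
have dNN b := etrans (diff_ambient b sN sN NN Dw) (pdr_cst b 1 w).
have dnN b := etrans (diff_ambient b sn sN nN Dw) (pdr_cst b 0 w).
have drx b := diff_ambient b (srb true) (srb true) rxx Dw.
have drxy b := diff_ambient b (srb true) (srb false) rxy Dw.
have dry b := diff_ambient b (srb false) (srb false) ryy Dw.
have e1 := drx false; rewrite cm in e1.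
have e2 := etrans (drxy false) (d0 false); rewrite cm in e2.
have e3 := etrans (dNr false true) (d0 false); rewrite cm in e3.
have e4 := etrans (dnr false true) (d0 false); rewrite cm (dn _ Dw) in e4.
have e5 := etrans (dnr true true) (d0 true); rewrite (dn _ Dw) in e5.
have e6 := etrans (dnr false false) (d0 false); rewrite (dn _ Dw) in e6.
have e7 := dnN true; rewrite (dn _ Dw) in e7.
have e8 := dnN false; rewrite (dn _ Dw) in e8.
exact: (ConformalFrame (l_gt0 Dw) nu_neq0 tau_nu (rxx Dw) (rxy Dw) (ryy Dw) (NN Dw)
  (Nr true Dw) (Nr false Dw) (nn Dw) (nr true Dw) (nr false Dw) (nN Dw)
  (drx true) e1 (etrans (drxy true) (d0 true)) e2 (dry true) (dry false) e5 e4 e6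
  (etrans (dNr true true) (d0 true)) (etrans (dNr true false) (d0 true)) e3
  (etrans (dNr false false) (d0 false)) (dNN true) (dNN false) e7 e8).
Qed.

Definition sff11 w := amb (pd true rx w) (N w).
Definition sff12 w := amb (pd true ry w) (N w).
Definition sff22 w := amb (pd false ry w) (N w).

Lemma smooth_sff11 : smooth D sff11. Proof. exact: smooth_ambient. Qed.
Lemma smooth_sff12 : smooth D sff12. Proof. exact: smooth_ambient. Qed.
Lemma smooth_sff22 : smooth D sff22. Proof. exact: smooth_ambient. Qed.

Let rxxy w : D w -> pd false (pd true rx) w = pd true (pd true ry) w.
Proof.
move=> Dw; rewrite -(pd_comm oD (srb true) Dw).
exact: (eq_pd true oD rcomm Dw).
Qed.

Lemma codazzi1 w : D w -> pdr false sff11 w - pdr true sff12 w =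
  pdr false l w * (sff11 w + sff22 w) / (2 * l w).
Proof.
move=> Dw; have := frame_codazzi1 (immersion_frame Dw).
rewrite (pdr_ambient oD c false (srbb true true) sN Dw).
rewrite (pdr_ambient oD c true (srbb true false) sN Dw) (rxxy Dw) => <-.
by rewrite opprD addrACA subrr add0r.
Qed.

Lemma codazzi2 w : D w -> pdr true sff22 w - pdr false sff12 w =
  pdr true l w * (sff11 w + sff22 w) / (2 * l w).
Proof.
move=> Dw; have := frame_codazzi2 (immersion_frame Dw).
rewrite (pdr_ambient oD c true (srbb false false) sN Dw).
rewrite (pdr_ambient oD c false (srbb true false) sN Dw).
rewrite (pd_comm oD (srb false) Dw) => <-.
by rewrite opprD addrACA subrr add0r.
Qed.

Lemma gauss w : D w -> sff11 w * sff22 w - sff12 w ^+ 2 =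
  - (pdr true (pdr true l) w + pdr false (pdr false l) w) / 2 +
  (pdr true l w ^+ 2 + pdr false l w ^+ 2) / (2 * l w) - c * l w ^+ 2.
Proof.
move=> Dw.
have slx := smooth_pd true sl; have sly := smooth_pd false sl.
have s2 := smooth_cst oD (2^-1 : R).
have p1 := diff_ambient false (srbb true true) (srb false)
  (k := fun v => - pdr false l v * 2^-1)
  (fun v Dv => frame_xxY (immersion_frame Dv)) Dw.
have p2 := diff_ambient true (srbb true false) (srb false)
  (k := fun v => pdr true l v * 2^-1)
  (fun v Dv => frame_xyY (immersion_frame Dv)) Dw.
rewrite (pdrM _ (smoothN oD sly) s2 Dw) (pdrN _ sly Dw) pdr_cst (rxxy Dw) in p1.
rewrite (pdrM _ slx s2 Dw) pdr_cst in p2.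
exact: gauss_arith p1 p2 (frame_gauss (immersion_frame Dw)).
Qed.

End gauss_codazzi.

(** * Analysis of the Gauss-Codazzi system *)

Lemma eq_has_pd (R : realType) b (f : cplx R -> R) w x y :
  has_pd b f w x -> x = y -> pdr b f w = y.
Proof. by move=> /has_pdE -> ->. Qed.

Lemma smooth_sub (R : realType) (D D' : set (cplx R)) (f : cplx R -> R) :
  D' `<=` D -> smooth D f -> smooth D' f.
Proof.
move=> D'D sf k; have := sf k; rewrite /smooth.
elim: k (f : cplx R -> R^o) {sf} => [|k IH] g.
  by move=> [cg _]; split => // w /D'D; exact: cg.
move=> /CkP[cg H]; apply/CkP; split => [w /D'D|b]; first exact: cg.
by have [dg Cg] := H b; split; [move=> w /D'D; exact: dg|exact: IH].
Qed.

Lemma open_smooth_neq0 (R : realType) (D : set (cplx R)) (f : cplx R -> R) :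
  open D -> smooth D f -> open (D `&` [set w | f w != 0]).
Proof.
move=> oD sf; rewrite openE => w [Dw fw].
have f0 : 0 < `|f w| by rewrite normr_gt0.
have [d d0 dP] := smooth_near sf Dw f0; have [e e0 eD] := open_box oD Dw.
apply/nbhs_box; exists (Num.min d e); first by rewrite lt_min d0.
move=> v [vx vy]; rewrite !lt_min in vx vy.
case/andP: vx => vx1 vx2; case/andP: vy => vy1 vy2; split; first exact: eD.
apply: contraTneq (dP v (conj vx1 vy1)) => ->.
by rewrite sub0r normrN ltxx.
Qed.

(** The derivative is found by structure as a unification variable; [eq_has_pd] then compares it
    with the wanted value. *)
Ltac has_pd_solve := repeat first
  [ eapply has_pdD | eapply has_pdN | eapply has_pdM | eapply has_pd_cst
  | eapply smooth_has_pd; [eassumption|eassumption] ].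

(** Elimination of q_x and q_y between the symmetry of the mixed derivatives of u (first equation)
    and the derivatives in y and x of q F = F_x / 2 - u G. *)
Lemma compatibility_arith (R : realFieldType)
    (u b q qx qy F Fx Fxx G Gx : R) :
  b * q * q + b * qx = b * q * q + u * qy ->
  qy * F + q * 0 = 0 * 2^-1 - (b * q * G + u * 0) ->
  qx * F + q * Fx = Fxx * 2^-1 - ((G + u * q) * G + u * Gx) ->
  F != 0 -> b != 0 -> q * F = Fx * 2^-1 - u * G ->
  u * (F * Gx - G * Fx) = F * Fxx * 2^-1 - F * (G * G) - Fx * Fx * 2^-1.
Proof.
move=> e1 e2 e3 F0 b0 e4.
have e5 : qx * F = - u * q * G.
  apply: (mulfI b0); have -> : b * (qx * F) = (b * qx) * F by ring.
  have -> : b * qx = u * qy by lra.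
  have -> : u * qy * F = u * (qy * F) by ring.
  have -> : qy * F = - (b * q * G) by lra.
  by ring.
have e6 : (q * F) * Fx = F * (Fxx * 2^-1 - G * G - u * Gx).
  have -> : Fxx * 2^-1 - G * G - u * Gx = q * Fx.
    by move: e3; rewrite e5 => e3; lra.
  by ring.
rewrite e4 in e6; lra.
Qed.

Lemma compatibility_arith2 (R : realFieldType) (u F Fx Fxx G : R) :
  u * 0 = F * Fxx * 2^-1 - F * (G * G) - Fx * Fx * 2^-1 ->
  F * Fxx - Fx * Fx = 2 * F * (G * G).
Proof. lra. Qed.

Section compatibility.
Context {R : realType}.
Variables (D : set (cplx R)) (u b q F G : cplx R -> R).
Hypothesis oD : open D.
Hypotheses (su : smooth D u) (sb : smooth D b) (sq : smooth D q).
Hypotheses (sF : smooth D F) (sG : smooth D G).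
Hypothesis Fy : forall w, D w -> pdr false F w = 0.
Hypothesis Gy : forall w, D w -> pdr false G w = 0.
Hypothesis bx : forall w, D w -> pdr true b w = b w * q w.
Hypothesis uy : forall w, D w -> pdr false u w = b w * q w.
Hypothesis ux : forall w, D w -> pdr true u w = G w + u w * q w.
Hypothesis qF : forall w, D w -> q w * F w = pdr true F w * 2^-1 - u w * G w.
Hypothesis b_neq0 : forall w, D w -> b w != 0.
Hypothesis q_neq0 : forall w, D w -> q w != 0.
Hypothesis F_neq0 : forall w, D w -> F w != 0.

Let sFx : smooth D (pdr true F) := smooth_pd true sF.
Let sFxx : smooth D (pdr true (pdr true F)) := smooth_pd true sFx.
Let sGx : smooth D (pdr true G) := smooth_pd true sG.

Let y_constant_pd f : smooth D f -> (forall v, D v -> pdr false f v = 0) ->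
  forall w, D w -> pdr false (pdr true f) w = 0.
Proof.
by move=> sf f0 w Dw; rewrite -(pdr_comm oD sf Dw) (pdr_eq oD true f0 Dw) pdr_cst.
Qed.

Let Fxy := y_constant_pd sF Fy.
Let Fxxy := y_constant_pd sFx Fxy.
Let Gxy := y_constant_pd sG Gy.

Let key w : D w -> u w * (F w * pdr true G w - G w * pdr true F w) =
  F w * pdr true (pdr true F) w * 2^-1 - F w * (G w * G w)
  - pdr true F w * pdr true F w * 2^-1.
Proof.
move=> Dw.
have e1 : pdr false (pdr true u) w = pdr true (pdr false u) w.
  by rewrite (pdr_comm oD su Dw).
have e2 : pdr false (pdr true u) w = pdr false u w * q w + u w * pdr false q w.
  rewrite (pdr_eq oD false ux Dw); apply: eq_has_pd; first by has_pd_solve.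
  by rewrite (Gy Dw) add0r.
have e3 : pdr true (pdr false u) w = pdr true b w * q w + b w * pdr true q w.
  by rewrite (pdr_eq oD true uy Dw); apply: eq_has_pd; first by has_pd_solve.
have eL i : pdr i (fun v => q v * F v) w = pdr i q w * F w + q w * pdr i F w.
  by apply: eq_has_pd; first by has_pd_solve.
have eR i : pdr i (fun v => pdr true F v * 2^-1 - u v * G v) w =
    pdr i (pdr true F) w * 2^-1 - (pdr i u w * G w + u w * pdr i G w).
  by apply: eq_has_pd; [has_pd_solve|rewrite mulr0 addr0].
have e4 := pdr_eq oD false qF Dw; have e5 := pdr_eq oD true qF Dw.
rewrite eL eR (Fy Dw) (Gy Dw) (uy Dw) (Fxy Dw) in e4; rewrite eL eR (ux Dw) in e5.
rewrite e1 e3 (bx Dw) (uy Dw) in e2.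
have := qF Dw; have := b_neq0 Dw; have := F_neq0 Dw; move: e2 e4 e5.
exact: compatibility_arith.
Qed.

(** In [key] only the factor u depends on y. Differentiating in y, with u_y = b q and b, q nonzero,
    kills the bracket and hence also the right-hand side. *)
Lemma compatibility w : D w ->
  F w * pdr true G w = G w * pdr true F w /\
  F w * pdr true (pdr true F) w - pdr true F w * pdr true F w =
  2 * F w * (G w * G w).
Proof.
move=> Dw; have e1 := pdr_eq oD false key Dw.
have eL : pdr false (fun w => u w * (F w * pdr true G w - G w * pdr true F w)) w =
    pdr false u w * (F w * pdr true G w - G w * pdr true F w).
  apply: eq_has_pd; first by has_pd_solve.
  by rewrite (Fy Dw) (Gxy Dw) (Gy Dw) (Fxy Dw); ring.
have eR : pdr false (fun w => F w * pdr true (pdr true F) w * 2^-1 - F w * (G w * G w)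
    - pdr true F w * pdr true F w * 2^-1) w = 0.
  apply: eq_has_pd; first by has_pd_solve.
  by rewrite (Fy Dw) (Fxxy Dw) (Gy Dw) (Fxy Dw); ring.
rewrite eL eR (uy Dw) in e1.
have e2 : F w * pdr true G w - G w * pdr true F w = 0.
  apply/eqP; move/eqP: e1; rewrite !mulf_eq0.
  by rewrite (negPf (b_neq0 Dw)) (negPf (q_neq0 Dw)).
have := key Dw; rewrite e2; move/eqP: e2; rewrite subr_eq0 => /eqP e2.
move=> e3; split; first exact: e2.
by move: e3; exact: compatibility_arith2.
Qed.

End compatibility.

(** The gradient of b is orthogonal to (u, b), hence a multiple q of (b, - u). *)
Lemma quotient_arith (R : realFieldType) (u b bx by_ F : R) :
  F != 0 -> u * u + b * b = F -> u * bx + b * by_ = 0 ->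
  let q := (b * bx - u * by_) * F^-1 in [/\ bx = b * q & by_ = - (u * q)].
Proof.
move=> F0 FE e q; rewrite /q; split; apply: (mulIf F0).
  have -> : b * ((b * bx - u * by_) * F^-1) * F = b * (b * bx - u * by_) by field.
  have -> : b * (b * bx - u * by_) = b * b * bx - u * (b * by_) by ring.
  by have -> : b * by_ = - (u * bx) by [lra]; rewrite -FE; ring.
have -> : - (u * ((b * bx - u * by_) * F^-1)) * F = - u * (b * bx - u * by_) by field.
have -> : - u * (b * bx - u * by_) = u * u * by_ - b * (u * bx) by ring.
by have -> : u * bx = - (b * by_) by [lra]; rewrite -FE; ring.
Qed.

Section weingarten_analysis.
Context {R : realType}.
Variables (D : set (cplx R)) (c : R) (l k H u b : cplx R -> R).
Hypothesis oD : open D.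
Hypotheses (sl : smooth D l) (sk : smooth D k) (sH : smooth D H).
Hypotheses (su : smooth D u) (sb : smooth D b).
Hypothesis ky : forall w, D w -> pdr false k w = 0.
Hypothesis ly : forall w, D w -> pdr false l w = 0.
Hypothesis Hy : forall w, D w -> pdr false H w = 0.
Hypothesis uy : forall w, D w -> pdr false u w = pdr true b w.
Hypothesis ux : forall w, D w -> pdr true u w + pdr false b w = l w * pdr true H w.
Hypothesis ub : forall w, D w ->
  u w * u w + b w * b w = l w * l w * (H w * H w - k w + c).
Hypothesis b_neq0 : forall w, D w -> b w != 0.
Hypothesis db_neq0 : forall w, D w ->
  pdr true b w * pdr true b w + pdr false b w * pdr false b w != 0.

(** By the Gauss equation F is u^2 + b^2; written through l, H and k it visibly has zero
    y-derivative, which u and b need not have. *)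
Let F w := l w * l w * (H w * H w - k w + c).
Let G w := l w * pdr true H w.
Let q w := (b w * pdr true b w - u w * pdr false b w) * (F w)^-1.

Let sHx : smooth D (pdr true H) := smooth_pd true sH.
Let sbx : smooth D (pdr true b) := smooth_pd true sb.
Let sby : smooth D (pdr false b) := smooth_pd false sb.

Let sF : smooth D F.
Proof.
exact: (smoothM oD (smoothM oD sl sl)
  (smoothD oD (smoothB oD (smoothM oD sH sH) sk) (smooth_cst oD c))).
Qed.
Let sG : smooth D G. Proof. exact: smoothM. Qed.

Lemma weingarten_F_gt0 w : D w -> 0 < F w.
Proof.
move=> Dw; rewrite /F -ub // -!expr2 ltr_wpDl ?sqr_ge0 //.
by rewrite lt0r sqr_ge0 andbT sqrf_eq0 b_neq0.
Qed.

Let F_neq0 w : D w -> F w != 0.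
Proof. by move=> Dw; rewrite gt_eqF ?weingarten_F_gt0. Qed.

Let sq : smooth D q.
Proof.
exact: (smoothM oD (smoothB oD (smoothM oD sb sbx) (smoothM oD su sby))
  (smoothV oD F_neq0 sF)).
Qed.

Let Fy w : D w -> pdr false F w = 0.
Proof.
move=> Dw; apply: eq_has_pd; first by has_pd_solve.
by rewrite (ly Dw) (Hy Dw) (ky Dw); ring.
Qed.

Let Gy w : D w -> pdr false G w = 0.
Proof.
move=> Dw; apply: eq_has_pd; first by has_pd_solve.
by rewrite (ly Dw) -(pdr_comm oD sH Dw) (pdr_eq oD true Hy Dw) pdr_cst; ring.
Qed.

Let F_pd i w : D w -> pdr i F w = 2 * (u w * pdr i u w + b w * pdr i b w).
Proof.
move=> Dw; rewrite -(pdr_eq oD i ub Dw); apply: eq_has_pd; first by has_pd_solve.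
by ring.
Qed.

Let quotient w : D w -> pdr true b w = b w * q w /\ pdr false b w = - (u w * q w).
Proof.
move=> Dw; have := Fy Dw; rewrite (F_pd _ Dw) (uy Dw) => e.
have e0 : u w * pdr true b w + b w * pdr false b w = 0.
  by move: e => /eqP; rewrite mulf_eq0 pnatr_eq0 => /eqP.
by have [] := quotient_arith (F_neq0 Dw) (ub Dw) e0.
Qed.

Lemma weingarten_compatibility w : D w ->
  F w * pdr true G w = G w * pdr true F w /\
  F w * pdr true (pdr true F) w - pdr true F w * pdr true F w =
  2 * F w * (G w * G w).
Proof.
apply: (@compatibility _ D u b q F G) => // {}w Dw; have [bx by_] := quotient Dw.
- by [].
- by rewrite (uy Dw).
- by rewrite /G -(ux Dw) by_; ring.
- have -> : q w * F w = b w * pdr true b w - u w * pdr false b w by rewrite /q divfK ?F_neq0.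
  by rewrite (F_pd _ Dw) /G -(ux Dw); field.
- have := db_neq0 Dw; apply: contra_neq => q0.
  by rewrite bx by_ q0; ring.
Qed.

End weingarten_analysis.

(** * The relations between K and H along a gradient line *)

Section derivatives.
Context {R : realType}.
Implicit Types f g : R -> R.

Definition der f t x := is_derive t (1 : R) f x.

Lemma derD f g t x y : der f t x -> der g t y ->
  der (fun s => f s + g s) t (x + y).
Proof. by move=> fx gy; exact: (is_deriveD fx gy). Qed.

Lemma derN f t x : der f t x ->
  der (fun s => - f s) t (- x).
Proof. by move=> fx; exact: (is_deriveN fx). Qed.

Lemma derM f g t x y : der f t x -> der g t y ->
  der (fun s => f s * g s) t (x * g t + f t * y).
Proof.
move=> fx gy; apply: is_derive_eq (is_deriveM fx gy) _.
by rewrite addrC; congr (_ + _); exact: mulrC.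
Qed.

Lemma derV f t x : f t != 0 -> der f t x ->
  der (fun s => (f s)^-1) t (- x * ((f t)^-1 * (f t)^-1)).
Proof.
move=> f0 fx; apply: is_derive_eq (is_deriveV f0 fx) _.
by rewrite -invfM -expr2 mulNr mulrC -mulNr.
Qed.

Lemma der_cst (a : R) t : der (fun _ => a) t 0.
Proof. exact: is_derive_cst. Qed.

Lemma eq_der f t x y : der f t x -> x = y -> der f t y.
Proof. by move=> fx <-. Qed.

Definition near_pt (x0 e t : R) : bool := `|t - x0| < e.

Lemma near_pt_near x0 e t : near_pt x0 e t -> \forall s \near t, near_pt x0 e s.
Proof.
move=> xt; apply: (@nbhs_real_ball _ t (e - `|t - x0|)); first by rewrite subr_gt0.
move=> s st; rewrite /near_pt -(subrK t s) -addrA.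
by rewrite (le_lt_trans (ler_normD _ _)) // -ltrBrDr.
Qed.

Lemma der_unique (x0 e : R) f g t x y : (forall s, near_pt x0 e s -> f s = g s) ->
  near_pt x0 e t -> der f t x -> der g t y -> x = y.
Proof.
move=> fg xt fx gy; have fgt : \forall s \near t, f s = g s.
  by apply: filterS (near_pt_near xt) => s; exact: fg.
have := near_eq_derive (1 : R) fgt.
by rewrite (@derive_val _ _ _ _ _ _ _ fx) (@derive_val _ _ _ _ _ _ _ gy).
Qed.

Lemma der_increasing (x0 e : R) (k k' : R -> R) : (forall t, near_pt x0 e t -> der k t (k' t)) ->
  (forall t, near_pt x0 e t -> 0 < k' t) ->
  forall s t, near_pt x0 e s -> near_pt x0 e t -> s < t -> k s < k t.
Proof.
move=> dk k'0 s t /[dup] xs /ltr_normlP[s1 s2] /[dup] xt /ltr_normlP[t1 t2] st.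
have mid u : s <= u <= t -> near_pt x0 e u.
  by move=> /andP[su ut]; apply/ltr_normlP; split; lra.
have [u /mid xu|u /mid xu eqk] := @MVT_closed _ k k' _ _ st; first exact: dk.
by rewrite -subr_gt0 eqk mulr_gt0 ?k'0 ?subr_gt0.
Qed.

(** As k is strictly increasing, it takes [size p] distinct values on the interval, too many roots
    for a nonzero p. *)
Lemma poly_vanish (x0 e : R) (k k' : R -> R) (p : {poly R}) : 0 < e ->
  (forall t, near_pt x0 e t -> der k t (k' t)) ->
  (forall t, near_pt x0 e t -> 0 < k' t) ->
  (forall t, near_pt x0 e t -> p.[k t] = 0) -> p = 0.
Proof.
move=> e0 dk k'0 pk; apply/eqP; apply: contraT => p0.
pose n := size p; pose x (i : nat) := x0 + e * (i%:R / n.+1%:R).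
have xI i : (i <= n)%N -> near_pt x0 e (x i).
  move=> i_n; rewrite /near_pt /x addrC addKr normrM gtr0_norm // gtr_pMr // ger0_norm //.
  by rewrite ltr_pdivrMr ?ltr0n // mul1r ltr_nat ltnS.
have x_lt i j : (i < j)%N -> x i < x j.
  by move=> ij; rewrite ltrD2l ltr_pM2l // ltr_pM2r ?invr_gt0 ?ltr0n // ltr_nat.
have := @max_poly_roots _ p [seq k (x i) | i <- iota 0 n] p0.
rewrite size_map size_iota ltnn => H; suff : false by [].
apply: H.
  rewrite all_map; apply/allP => i; rewrite mem_iota /= => i_n.
  by rewrite /root pk // xI // ltnW.
rewrite map_inj_in_uniq ?iota_uniq // => i j; rewrite !mem_iota !add0n /= => i_n j_n kij.
have [ij|ji|//] := ltngtP i j.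
  by have := der_increasing dk k'0 (xI i (ltnW i_n)) (xI j (ltnW j_n)) (x_lt _ _ ij); rewrite kij ltxx.
by have := der_increasing dk k'0 (xI j (ltnW j_n)) (xI i (ltnW i_n)) (x_lt _ _ ji); rewrite kij ltxx.
Qed.

End derivatives.

(** * Solutions of the Riccati equation are not algebraic *)

Section riccati_curve.
Context {R : realType}.
Variables (x0 e : R) (k k' h : R -> R) (q : {poly R}).
Hypothesis e_gt0 : 0 < e.
Hypothesis size_q : size q = 2%N.
Hypothesis dk : forall t, near_pt x0 e t -> der k t (k' t).
Hypothesis k'_gt0 : forall t, near_pt x0 e t -> 0 < k' t.
Hypothesis dh : forall t, near_pt x0 e t ->
  der h t (k' t * (h t * h t - q.[k t])).

Let ev (F : {poly {poly R}}) t := F.[(h t)%:P].[k t].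

Let der_poly (p : {poly R}) t : near_pt x0 e t ->
  der (fun s => p.[k s]) t (k' t * p^`().[k t]).
Proof.
move=> xt; have := dk xt => dkt; rewrite mulrC.
exact: (@is_derive1_comp _ (horner p) k t _ _ (is_derive_poly p (k t)) dkt).
Qed.

Let riccati_deriv_MXaddC (F : {poly {poly R}}) (p : {poly R}) :
  riccati_deriv q (F * 'X + p%:P) =
  riccati_deriv q F * 'X + F * ('X^2 - q%:P) + (p^`())%:P.
Proof.
rewrite /riccati_deriv derivD derivM derivX derivC addr0 mulr1.
have -> : map_poly (@deriv R) (F * 'X + p%:P) = map_poly (@deriv R) F * 'X + (p^`())%:P.
  apply/polyP => i; rewrite coef_map !coefD !coefMX !coefC coef_map /= derivD.
  by case: eqP => _; rewrite ?deriv0 ?derivD ?deriv0.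
by rewrite mulrDl mulrDl; ring.
Qed.

(** Chain rule along the curve (k, h), by Horner induction on F; the factor k' appears because the
    field is parametrized by k. *)
Let ev_deriv F t : near_pt x0 e t ->
  der (ev F) t (k' t * ev (riccati_deriv q F) t).
Proof.
move=> xt; elim/poly_ind: F => [|F p IH].
  have -> : ev 0 = fun _ => 0 by apply/funext => s; rewrite /ev !horner0.
  apply: eq_der (der_cst _ _) _.
  by rewrite /riccati_deriv map_poly0 deriv0 mul0r addr0 /ev !horner0 mulr0.
have -> : ev (F * 'X + p%:P) = fun s => ev F s * h s + p.[k s].
  by apply/funext => s; rewrite /ev !hornerE.
apply: eq_der (derD (derM IH (dh xt)) (der_poly p xt)) _.
have -> : ev (riccati_deriv q (F * 'X + p%:P)) t = ev (riccati_deriv q F) t * h t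
    + ev F t * (h t * h t - q.[k t]) + p^`().[k t].
  by rewrite riccati_deriv_MXaddC /ev !hornerE /= expr2.
by ring.
Qed.

(** The polynomials vanishing on the curve form a saturated differential ideal, to which
    [riccati_ideal_eq0] applies. *)
Lemma riccati_not_algebraic (F : {poly {poly R}}) :
  (forall t, near_pt x0 e t -> F.[(h t)%:P].[k t] = 0) -> F = 0.
Proof.
apply: (riccati_ideal_eq0 size_q (V := fun F => forall t, near_pt x0 e t -> ev F t = 0)).
- by move=> {}F G VF VG t xt; rewrite /ev hornerD hornerD -/(ev F t) -/(ev G t) VF ?VG ?addr0.
- by move=> {}F G VF t xt; rewrite /ev hornerM hornerM -/(ev F t) VF ?mulr0.
- move=> {}F VF t xt.
  have /eqP := der_unique (g := fun _ => 0) VF xt (ev_deriv F xt) (der_cst _ _).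
  by rewrite mulf_eq0 gt_eqF ?k'_gt0 //= => /eqP.
(* Saturation: if F is nonzero at t, it is nonzero nearby, so p vanishes at all nearby values of k
   and must be zero. *)
- move=> p {}F p0 VpF t xt; apply/eqP; apply: contraT => Ft.
  have cF : {for t, continuous (ev F)}.
    by apply/differentiable_continuous/derivable1_diffP; have [] := ev_deriv F xt.
  have : \forall s \near t, near_pt x0 e s /\ ev F s != 0.
    apply: filterI; first exact: near_pt_near.
    have F0 : 0 < `|ev F t| by rewrite normr_gt0.
    move/cvgrPdist_lt: cF => /(_ _ F0); apply: filterS => s.
    by apply: contraTneq => ->; rewrite subr0 ltxx.
  move=> /nbhs_ballP[d /= d0 dP].
  have {}dP s : near_pt t d s -> near_pt x0 e s /\ ev F s != 0.
    by move=> ts; apply: dP; rewrite -ball_normE /ball_ /= distrC.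
  case/negP: p0; apply/eqP.
  apply: (@poly_vanish _ t d k k' p) => // s /dP[xs Fs]; [exact: dk|exact: k'_gt0|].
  have /eqP := VpF s xs; rewrite /ev hornerM hornerM hornerC -/(ev F s) mulf_eq0.
  by rewrite (negPf Fs) orbF => /eqP.
- move=> /(_ x0); rewrite /near_pt subrr normr0 /ev !hornerC => /(_ e_gt0)/eqP.
  by rewrite oner_eq0.
Qed.

End riccati_curve.

(** * The cubic that expresses the metric through its curvature *)

Section cubic.
Context {R : realFieldType}.
Variables alpha beta : R.

(** There is no square term, as in - 4/3 (K - K1) (K - K2) (K + K1 + K2), whose roots have sum zero;
    [alpha] and [beta] arise as constants of integration. *)
Definition cubic : {poly R} :=
  (- (4 / 3)) *: 'X^3 + (2 * alpha) *: 'X + beta%:P.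

Lemma cubicE x : cubic.[x] = beta + 2 * alpha * x - 4 / 3 * (x * x * x).
Proof. by rewrite /cubic !hornerE /=; ring. Qed.

Lemma deriv_cubic : cubic^`() = (- 4) *: 'X^2 + (2 * alpha)%:P.
Proof.
rewrite /cubic !derivD !derivZ derivXn derivX derivC addr0 /= alg_polyC.
rewrite -(scaler_nat 3 'X^2) scalerA; by congr (_ *: _ + _); field.
Qed.

Lemma deriv_cubicE x : cubic^`().[x] = 2 * alpha - 4 * (x * x).
Proof. by rewrite deriv_cubic !hornerE /=; ring. Qed.

Lemma deriv2_cubicE x : cubic^`()^`().[x] = - 8 * x.
Proof.
by rewrite deriv_cubic derivD derivZ derivXn derivC addr0 /= -(scaler_nat 2 'X^1) !hornerE /=; ring.
Qed.

Lemma size_cubic : size cubic = 4%N.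
Proof.
have c0 : - (4 / 3) != 0 :> R by rewrite oppr_eq0 mulf_neq0 ?invr_eq0 ?pnatr_eq0.
rewrite /cubic -addrA size_polyDl size_scale ?size_polyXn //.
apply: leq_ltn_trans (size_polyD _ _) _; rewrite gtn_max.
rewrite (leq_ltn_trans (size_scale_leq _ _)) ?size_polyX //=.
by rewrite (leq_ltn_trans (size_polyC_leq1 _)).
Qed.

Lemma deriv_cubic_neq0 : cubic^`() != 0.
Proof.
apply/eqP => /(congr1 (fun p : {poly R} => p`_2)).
rewrite deriv_cubic coefD coefZ coefXn coefC coef0 /= mulr1 addr0 => /eqP.
by rewrite oppr_eq0 pnatr_eq0.
Qed.

End cubic.

Ltac der_solve := repeat first
  [ eassumption | eapply derD | eapply derN | eapply derM | eapply der_cst ].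

(** With F = l^2 s, the two sides of F F'' - F'^2 = 2 F (C F)^2 differ by l^5 / 2 times the
    relation. *)
Lemma liouville_arith (R : realFieldType) (l s p1 p2 C H : R) :
  let V := 2 * C * H * s - 2^-1 in let T := p1 * s + l * V in l != 0 ->
  l * l * s * (l * l * (p1 * T + (p2 * (l * 2^-1) * s + p1 * (l * V) +
    p1 * (l * 2^-1) * V + l * (l * (2 * C * (C * (s * s) + H * V)))))) -
    l * l * T * (l * l * T) = 2 * (l * l * s) * (C * (l * l * s) * (C * (l * l * s))) ->
  s * s * p2 + (s * p1 + l) * V = 0.
Proof.
move=> V T l0 /eqP; rewrite -subr_eq0 => /eqP e0.
have : l ^+ 5 * (s * s * p2 + (s * p1 + l) * V) = 0.
  by rewrite -[RHS](mulr0 2) -[in RHS]e0 /T /V; field.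
by move/eqP; rewrite mulf_eq0 expf_eq0 (negPf l0) /= => /eqP.
Qed.

(** * Curvature equation and Liouville equation on a gradient line *)

Section hcmu_line.
Context {R : realType}.
Variables (x0 e : R) (k l l1 l2 : R -> R).
Hypothesis e_gt0 : 0 < e.
Hypothesis l_gt0 : forall t, near_pt x0 e t -> 0 < l t.
Hypothesis dk : forall t, near_pt x0 e t -> der k t (l t * 2^-1).
Hypothesis dl : forall t, near_pt x0 e t -> der l t (l1 t).
Hypothesis dl1 : forall t, near_pt x0 e t -> der l1 t (l2 t).
Hypothesis curvature : forall t, near_pt x0 e t ->
  2 * k t * (l t * l t * l t) = l1 t * l1 t - l2 t * l t.

Let dk_gt0 t : near_pt x0 e t -> 0 < l t * 2^-1.
Proof. by move=> xt; rewrite mulr_gt0 ?l_gt0 ?invr_gt0. Qed.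

Let near_x0 : near_pt x0 e x0. Proof. by rewrite /near_pt subrr normr0. Qed.

(* Along a gradient line the curvature equation is a total derivative. *)
Lemma density_cubic : exists alpha beta, forall t, near_pt x0 e t ->
  l t = (cubic alpha beta).[k t] /\ l1 t = (cubic alpha beta)^`().[k t] * (l t * 2^-1).
Proof.
(* A first integral: the curvature equation says (l' / l)' = - 2 k l, and 2 k l is the derivative of
   2 k^2. *)
pose f t := l1 t * (l t)^-1 + 2 * (k t * k t).
have [alpha fE] : exists alpha, forall t, near_pt x0 e t -> f t = alpha.
  exists (f x0) => t xt; apply: (zero_derive_eq (c := x0) (e := e)) => // {xt}t xt.
  have lt := l_gt0 xt. have dkt := dk xt. have dlt := dl xt. have dl1t := dl1 xt.
  have l0 : l t != 0 by rewrite gt_eqF.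
  have dV := derV l0 dlt.
  rewrite /f; apply: eq_der; first by der_solve.
  have -> : l2 t = (l1 t * l1 t - 2 * k t * (l t * l t * l t)) / l t.
    by rewrite curvature //; field.
  by field.
have l1E t : near_pt x0 e t -> l1 t = (alpha - 2 * (k t * k t)) * l t.
  by move=> xt; rewrite -(fE t xt) /f; field; rewrite gt_eqF ?l_gt0.
(* Now l' = (alpha - 2 k^2) l = 2 (alpha - 2 k^2) k', which integrates to a cubic in k. *)
pose g t := l t - 2 * alpha * k t + 4 / 3 * (k t * k t * k t).
have [beta gE] : exists beta, forall t, near_pt x0 e t -> g t = beta.
  exists (g x0) => t xt; apply: (zero_derive_eq (c := x0) (e := e)) => // {xt}t xt.
  have dkt := dk xt. have dlt := dl xt.
  rewrite /g; apply: eq_der; first by der_solve.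
  by rewrite l1E //; field.
exists alpha, beta => t xt; rewrite cubicE deriv_cubicE; split.
  by rewrite -(gE t xt) /g; ring.
by rewrite l1E //; field.
Qed.

(** Since l is a cubic in k, the left side is a polynomial of degree 7 in k, while k is strictly
    increasing. *)
Lemma density_curvature_nonconstant (c a : R) :
  ~ forall t, near_pt x0 e t -> l t * l t * (k t - c) = a.
Proof.
move=> la; have [alpha [beta lE]] := density_cubic.
pose p := cubic alpha beta * cubic alpha beta * ('X - c%:P) - a%:P.
have /eqP : p = 0.
  apply: (poly_vanish e_gt0 dk dk_gt0) => t xt.
  by rewrite /p hornerD hornerN hornerC !hornerM hornerXsubC -(proj1 (lE t xt)) (la t xt) subrr.
have P0 : cubic alpha beta != 0 by rewrite -size_poly_eq0 size_cubic.
rewrite subr_eq0 => /eqP /(congr1 (fun p : {poly R} => size p)).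
rewrite size_mul ?mulf_neq0 ?polyXsubC_eq0 // size_mul // size_XsubC size_cubic.
by move=> s8; have := size_polyC_leq1 a; rewrite -s8.
Qed.

Variables (c C : R) (H F F1 F2 : R -> R).
Hypothesis FE : forall t, near_pt x0 e t -> F t = l t * l t * (H t * H t - k t + c).
Hypothesis dH : forall t, near_pt x0 e t ->
  der H t (C * l t * (H t * H t - k t + c)).
Hypothesis dF : forall t, near_pt x0 e t -> der F t (F1 t).
Hypothesis dF1 : forall t, near_pt x0 e t -> der F1 t (F2 t).
Hypothesis FF : forall t, near_pt x0 e t ->
  F t * F2 t - F1 t * F1 t = 2 * F t * (C * F t * (C * F t)).

Let der_poly (p : {poly R}) t : near_pt x0 e t ->
  der (fun s => p.[k s]) t (p^`().[k t] * (l t * 2^-1)).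
Proof. by move=> xt; exact: (is_derive1_comp (is_derive_poly p (k t)) (dk xt)). Qed.

(** Divided by F^2, the hypothesis [FF] is the Liouville equation (ln F)'' = 2 C^2 F. Substituting F
    = l^2 s and l = P(k) makes it algebraic in H and k. *)
Lemma liouville_relation alpha beta : let P := cubic alpha beta in
  (forall t, near_pt x0 e t -> l t = P.[k t] /\ l1 t = P^`().[k t] * (l t * 2^-1)) ->
  forall t, near_pt x0 e t -> let s := H t * H t - k t + c in
  s * s * P^`()^`().[k t] + (s * P^`().[k t] + P.[k t]) * (2 * C * H t * s - 2^-1) = 0.
Proof.
move=> P lE t xt s.
pose S t := H t * H t - k t + c.
(* The derivative of [S] is l V, because H' = C l S and k' = l / 2. *)
pose V t := 2 * C * H t * S t - 2^-1.
have dS u : near_pt x0 e u -> der S u (l u * V u).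
  move=> xu; have dHu := dH xu. have dku := dk xu.
  by apply: eq_der; [der_solve|rewrite /V /S; field].
pose T u := P^`().[k u] * S u + l u * V u.
have F1E u : near_pt x0 e u -> F1 u = l u * l u * T u.
  move=> xu; apply: (der_unique FE xu (dF xu)); have dlu := dl xu. have dSu := dS u xu.
  apply: eq_der; first exact: (derM (derM dlu dlu) dSu).
  by rewrite (lE u xu).2 /T; field.
have dV u : near_pt x0 e u ->
    der V u (l u * (2 * C * (C * (S u * S u) + H u * V u))).
  move=> xu; have dHu : der H u (C * l u * S u) := dH xu; have dSu := dS u xu.
  by apply: eq_der; [der_solve|rewrite /V; ring].
have F2E u : near_pt x0 e u -> F2 u = l u * l u * (P^`().[k u] * T u +
    (P^`()^`().[k u] * (l u * 2^-1) * S u + P^`().[k u] * (l u * V u) +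
     (P^`().[k u] * (l u * 2^-1)) * V u +
     l u * (l u * (2 * C * (C * (S u * S u) + H u * V u))))).
  move=> xu; apply: (der_unique F1E xu (dF1 xu)).
  have dlu := dl xu. have dSu := dS u xu. have dVu := dV u xu. have dPu := der_poly P^`() xu.
  have dTu := derD (derM dPu dSu) (derM dlu dVu).
  apply: eq_der; first exact: (derM (derM dlu dlu) dTu).
  by rewrite (lE u xu).2 -/(T u); field.
have l0 : l t != 0 by rewrite gt_eqF ?l_gt0.
have := FF xt; rewrite (F2E t xt) (F1E t xt) (FE xt) -(proj1 (lE t xt)) => e0.
exact: liouville_arith l0 e0.
Qed.

(** For C = 0 the function H is constant and the relation is a polynomial identity in k. For C <> 0
    the function h = 2 C H solves dh/dk = h^2 - 4 C^2 (k - c), and the relation would make it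
    algebraic over k. *)
Lemma hcmu_line_absurd : False.
Proof.
have [alpha [beta lE]] := density_cubic.
pose P := cubic alpha beta; pose p1 := P^`(); pose p2 := p1^`().
have rel := liouville_relation lE; have p1_neq0 : p1 != 0 := deriv_cubic_neq0 alpha beta.
have [C0|C0] := eqVneq C 0.
  have HE t : near_pt x0 e t -> H t = H x0.
    move=> xt; apply: (zero_derive_eq (c := x0) (e := e)) => // u xu.
    by apply: (eq_der (dH xu)); rewrite C0 !mul0r.
  pose a := H x0 * H x0 + c.
  (* The relation at constant H, expanded in k. The leading coefficient collects - 8 from s^2 P''
     and - 4/3 from - (s P' + P) / 2. *)
  pose p : {poly R} := (- (28 / 3)) *: 'X^3 + (18 * a) *: 'X^2
    + (- 8 * (a * a)) *: 'X + (- alpha * a - beta / 2)%:P.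
  have : p = 0.
    apply: (poly_vanish e_gt0 dk dk_gt0) => t xt.
    have := rel t xt; rewrite -/P -/p1 -/p2 (HE t xt) C0.
    rewrite cubicE deriv_cubicE deriv2_cubicE => <-.
    by rewrite /p !hornerE /= /a; field.
  move=> /(congr1 (fun p : {poly R} => p`_3)).
  rewrite !coefD !coefZ !coefXn coefX coefC coef0 /= !mulr0 !addr0 mulr1 => /eqP.
  by rewrite oppr_eq0 mulf_eq0 invr_eq0 !pnatr_eq0.
have {}rel t : near_pt x0 e t -> (H t * H t - k t + c) * (H t * H t - k t + c) * p2.[k t]
    + ((H t * H t - k t + c) * p1.[k t] + P.[k t])
      * (2 * C * H t * (H t * H t - k t + c) - 2^-1) = 0 := rel t.
clearbody p2 p1 P; pose d : R := 4 * C ^+ 2.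
have d0 : d != 0 by rewrite mulf_neq0 ?expf_neq0 ?pnatr_eq0.
have [q [size_q qE]] : exists q : {poly R}, size q = 2%N /\
    forall x, q.[x] = 4 * C ^+ 2 * (x - c).
  exists (d *: ('X - c%:P)); rewrite size_scale // size_XsubC; split => // x.
  by rewrite hornerZ hornerXsubC.
pose h t := 2 * C * H t.
have dh t : near_pt x0 e t -> der h t (l t * 2^-1 * (h t * h t - q.[k t])).
  move=> xt; have dHt := dH xt.
  apply: (eq_der (derM (der_cst (2 * C) t) dHt)).
  by rewrite /h qE; field.
(* The relation [rel], multiplied by [d ^+ 2], as a polynomial in [h]: since
   [d * (H ^+ 2 - k + c) = h ^+ 2 - q(k)], its leading coefficient is [p1]. *)
pose Phi : {poly {poly R}} := Poly [::
  q * q * p2 + (d / 2) *: (q * p1) - (d * d / 2) *: P; q * q * p1 - d *: (q * P);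
  - 2%:R *: (q * p2) - (d / 2) *: p1; - 2%:R *: (q * p1) + d *: P; p2; p1].
have Phi0 : Phi = 0.
  apply: (riccati_not_algebraic e_gt0 size_q dk dk_gt0 dh) => t xt.
  rewrite horner_Poly /= mul0r add0r.
  have := rel t xt.
  rewrite !(hornerD, hornerM, hornerN, hornerZ, hornerC) qE /h.
  move: (H t) (k t) (p1.[k t]) (p2.[k t]) (P.[k t]) => H0 k0 y1 y2 y0 e0.
  have -> : 0 = d * d * 0 :> R by rewrite mulr0.
  by rewrite -e0 /d; field.
have := congr1 (fun F : {poly {poly R}} => F`_5) Phi0.
by rewrite coef_Poly coef0 /=; apply/eqP.
Qed.

End hcmu_line.

(** * Constancy of h12 *)

(** For u = (a - d) / 2 and H = (a + d) / (2 l), Codazzi gives b_y = d_x - l_x H, so that u_x + b_y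
    = (a + d)_x / 2 - l_x H = l H_x. *)
Lemma weingarten_arith (R : realFieldType) (a d l ax dx by_ lx Hx : R) : l != 0 ->
  dx - by_ = lx * (a + d) / (2 * l) ->
  Hx = (ax + dx) * (2^-1 * l^-1) + (a + d) * (2^-1 * (- lx * (l^-1 * l^-1))) ->
  (ax - dx) * 2^-1 + by_ = l * Hx.
Proof.
move=> l0 e ->; have -> : by_ = dx - lx * (a + d) / (2 * l) by rewrite -e; ring.
by field.
Qed.

Section hcmu_weingarten.
Context {R : realType}.
Variables (D : set (cplx R)) (c : R) (l k a b d : cplx R -> R).
Hypotheses (oD : open D) (cD : connected D).
Hypotheses (sl : smooth D l) (sk : smooth D k).
Hypotheses (sa : smooth D a) (sb : smooth D b) (sd : smooth D d).
Hypothesis l_gt0 : forall w, D w -> 0 < l w.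
Hypothesis kx : forall w, D w -> pdr true k w = l w * 2^-1.
Hypothesis ky : forall w, D w -> pdr false k w = 0.
Hypothesis curvature : forall w, D w -> 2 * k w * (l w * l w * l w) =
  pdr true l w * pdr true l w + pdr false l w * pdr false l w -
  (pdr true (pdr true l) w + pdr false (pdr false l) w) * l w.
Hypothesis codazzi1 : forall w, D w -> pdr false a w - pdr true b w =
  pdr false l w * (a w + d w) / (2 * l w).
Hypothesis codazzi2 : forall w, D w -> pdr true d w - pdr false b w =
  pdr true l w * (a w + d w) / (2 * l w).
Hypothesis gauss : forall w, D w -> a w * d w - b w * b w = l w * l w * (k w - c).

Let H w := (a w + d w) * (2^-1 * (l w)^-1).

Let l_neq0 w : D w -> l w != 0. Proof. by move=> Dw; rewrite gt_eqF ?l_gt0. Qed.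
Let slV := smoothV oD l_neq0 sl.
Let sH : smooth D H.
Proof. exact: (smoothM oD (smoothD oD sa sd) (smoothM oD (smooth_cst oD _) slV)). Qed.

(** As l = 2 k_x, its y-derivative is 2 k_xy, which vanishes with k_y. *)
Lemma density_y w : D w -> pdr false l w = 0.
Proof.
move=> Dw; have e1 : pdr false (pdr true k) w = pdr false l w * 2^-1.
  rewrite (pdr_eq oD false kx Dw); apply: eq_has_pd; first by has_pd_solve.
  by rewrite mulr0 addr0.
have e2 : pdr false (pdr true k) w = 0.
  by rewrite -(pdr_comm oD sk Dw) (pdr_eq oD true ky Dw) pdr_cst.
by move/eqP: e1; rewrite e2 eq_sym mulf_eq0 invr_eq0 pnatr_eq0 orbF => /eqP.
Qed.

Let H_pd i w : D w -> pdr i H w = (pdr i a w + pdr i d w) * (2^-1 * (l w)^-1) +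
  (a w + d w) * (2^-1 * (- pdr i l w * ((l w)^-1 * (l w)^-1))).
Proof.
move=> Dw; have := has_pdV (l_neq0 Dw) (smooth_has_pd i sl Dw) => dV.
apply: eq_has_pd.
  by apply: (has_pdM (has_pdD _ _) (has_pdM (has_pd_cst _ _ _) dV)); has_pd_solve.
by rewrite mul0r add0r.
Qed.

Let Hy w : D w -> pdr false H w = (pdr false a w + pdr false d w) * (2^-1 * (l w)^-1).
Proof. by move=> Dw; rewrite (H_pd false Dw) (density_y Dw); ring. Qed.

Let line_der f w e : smooth D f -> box w e `<=` D ->
  forall t, near_pt (complex.Re w) e t ->
  der (fun s => f (s +i* complex.Im w)) t (pdr true f (t +i* complex.Im w)).
Proof.
move=> sf eD t wt; apply: (smooth_has_pd true sf (w := t +i* complex.Im w)).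
by apply: eD; split => //; case: w wt => ? ? /= wt; rewrite subrr normr0 (le_lt_trans _ wt).
Qed.

Let line_in w e : box w e `<=` D ->
  forall t, near_pt (complex.Re w) e t -> D (t +i* complex.Im w).
Proof.
move=> eD t wt; apply: eD; split => //.
by case: w wt => ? ? /= wt; rewrite subrr normr0 (le_lt_trans _ wt).
Qed.

Let line_k w e : box w e `<=` D -> forall t, near_pt (complex.Re w) e t ->
  der (fun s => k (s +i* complex.Im w)) t (l (t +i* complex.Im w) * 2^-1).
Proof.
move=> eD t wt; rewrite -(kx (line_in eD wt)); exact: (line_der sk eD wt).
Qed.

Let line_l_gt0 w e : box w e `<=` D -> forall t, near_pt (complex.Re w) e t ->
  0 < l (t +i* complex.Im w).
Proof. by move=> eD t wt; apply: l_gt0; exact: (line_in eD wt). Qed.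

Let line_curvature w e : box w e `<=` D ->
  forall t, near_pt (complex.Re w) e t -> let v := t +i* complex.Im w in
  2 * k v * (l v * l v * l v) =
  pdr true l v * pdr true l v - pdr true (pdr true l) v * l v.
Proof.
move=> eD t wt v; have Dv := line_in eD wt; rewrite (curvature Dv).
by rewrite (density_y Dv) (pdr_eq oD false density_y Dv) pdr_cst; ring.
Qed.

Lemma constant_h12_weingarten (a0 : R) : (forall w, D w -> b w = a0) ->
  forall w, D w -> pdr false H w = 0.
Proof.
move=> bE w0 Dw0; apply/eqP; apply: contraT => Hy0.
have sHy := smooth_pd false sH.
have [e e0 eD] := open_box (open_smooth_neq0 oD sHy) (conj Dw0 Hy0).
have eD1 : box w0 e `<=` D by move=> v /eD[].
(* With a_y = b_x = 0, the y-derivative of the Gauss equation is a d_y = 0, and d_y = 0 would give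
   H_y = 0. *)
have a_eq0 v : box w0 e v -> a v = 0.
  move=> /eD[Dv Hyv].
  have ay : pdr false a v = 0.
    have := codazzi1 Dv; rewrite (density_y Dv) (pdr_eq oD true bE Dv) pdr_cst => e1.
    by rewrite -[LHS]subr0 e1 !mul0r.
  have gy := pdr_eq oD false gauss Dv.
  have gL : pdr false (fun v => a v * d v - b v * b v) v = a v * pdr false d v.
    apply: eq_has_pd; first by has_pd_solve.
    by rewrite ay (pdr_eq oD false bE Dv) pdr_cst; ring.
  have gR : pdr false (fun v => l v * l v * (k v - c)) v = 0.
    apply: eq_has_pd; first by has_pd_solve.
    by rewrite (density_y Dv) (ky Dv); ring.
  rewrite gL gR in gy; move/eqP: gy; rewrite mulf_eq0 => /orP[/eqP //|/eqP dy].
  have : pdr false H v != 0 := Hyv.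
  by rewrite (Hy Dv) ay dy addr0 mul0r eqxx.
(* With a = 0 and b = a0 the Gauss equation reads l^2 (k - c) = - a0^2 on the horizontal line
   through w0. *)
have [] := @density_curvature_nonconstant _ _ _ _ _ _ _ e0 (line_l_gt0 eD1)
  (line_k eD1) (line_der sl eD1) (line_der (smooth_pd true sl) eD1) (line_curvature eD1)
  c (- (a0 * a0)).
move=> t wt; set v := t +i* complex.Im w0.
have Dv : D v := line_in eD1 wt.
have av : a v = 0.
  apply: a_eq0; split => //; rewrite /= subrr normr0 //.
by rewrite -(gauss Dv) av (bE _ Dv); ring.
Qed.

Lemma weingarten_constant_h12 : (forall w, D w -> pdr false H w = 0) ->
  exists a0 : R, forall w, D w -> b w = a0.
Proof.
move=> Hy0.
pose g w := pdr true b w * pdr true b w + pdr false b w * pdr false b w.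
have sbx := smooth_pd true sb; have sby := smooth_pd false sb.
have sg : smooth D g := smoothD oD (smoothM oD sbx sbx) (smoothM oD sby sby).
suff g0 w : D w -> g w = 0.
  by apply: (connected_cst oD sb cD) => w Dw; apply/eqP;
    move/eqP: (g0 _ Dw); rewrite paddr_eq0 -?expr2 ?sqr_ge0 // !sqrf_eq0 => /andP[].
move=> Dw; apply/eqP; apply: contraT => gw.
(* The set where the gradient of b is nonzero is open; if b vanished on all of it, its gradient
   would vanish there too. So b and its gradient are both nonzero at some v. *)
have [v [Dv bg]] : exists v, D v /\ b v * g v != 0.
  apply: contrapT => no; have oD1 := open_smooth_neq0 oD sg.
  have b0 v : (D `&` [set w | g w != 0]) v -> b v = 0.
    move=> [Dv gv]; apply/eqP; apply: contraT => bv; case: no.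
    by exists v; split => //; rewrite mulf_neq0.
  have bp i : pdr i b w = 0.
    by rewrite (pdr_eq oD1 i b0 (conj Dw gw)) pdr_cst.
  by move: gw; rewrite /g !bp mulr0 addr0 eqxx.
pose D' := D `&` [set w | b w * g w != 0].
have oD' : open D' := open_smooth_neq0 oD (smoothM oD sb sg).
have D'D : D' `<=` D by move=> ? [].
have res f (sf : smooth D f) : smooth D' f := smooth_sub D'D sf.
pose u v := (a v + - d v) * 2^-1.
have su : smooth D u := smoothM oD (smoothB oD sa sd) (smooth_cst oD _).
have ad x : D x -> pdr false a x + pdr false d x = 0.
  move=> Dx; move/eqP: (Hy Dx); rewrite Hy0 // eq_sym mulf_eq0 => /orP[/eqP //|].
  by rewrite mulf_eq0 !invr_eq0 pnatr_eq0 (negPf (l_neq0 Dx)).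
have ayx x : D x -> pdr false a x = pdr true b x.
  move=> Dx; have := codazzi1 Dx; rewrite (density_y Dx) !mul0r => /eqP.
  by rewrite subr_eq0 => /eqP.
have u_pd i x : D x -> pdr i u x = (pdr i a x + - pdr i d x) * 2^-1.
  by move=> Dx; apply: eq_has_pd; [rewrite /u; has_pd_solve|rewrite mulr0 addr0].
have uy x : D x -> pdr false u x = pdr true b x.
  move=> Dx; rewrite (u_pd _ _ Dx) -(ayx _ Dx).
  by rewrite -[pdr false d x](addKr (pdr false a x)) (ad _ Dx) addr0; field.
have ux x : D x -> pdr true u x + pdr false b x = l x * pdr true H x.
  move=> Dx; rewrite (u_pd _ _ Dx).
  exact: weingarten_arith (l_neq0 Dx) (codazzi2 Dx) (H_pd true Dx).
have ub x : D x -> u x * u x + b x * b x = l x * l x * (H x * H x - k x + c).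
  move=> Dx; have -> : k x = (a x * d x - b x * b x) / (l x * l x) + c.
    by rewrite (gauss Dx); field; rewrite l_neq0.
  by rewrite /u /H; field; rewrite l_neq0.
have [e e0 eD] := open_box oD' (conj Dv bg).
have eD1 : box v e `<=` D := subset_trans eD D'D.
have bD x : D' x -> b x != 0 by move=> [_ /=]; apply: contra_neq => ->; rewrite mul0r.
have gD x : D' x -> g x != 0 by move=> [_ /=]; apply: contra_neq => ->; rewrite mulr0.
pose F v := l v * l v * (H v * H v - k v + c); pose G v := l v * pdr true H v.
have sF : smooth D F := smoothM oD (smoothM oD sl sl)
  (smoothD oD (smoothB oD (smoothM oD sH sH) sk) (smooth_cst oD c)).
have sG : smooth D G := smoothM oD sl (smooth_pd true sH).
have F_gt0 x : D' x -> 0 < F x.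
  by move=> D'x; apply: (weingarten_F_gt0 (fun w D'w => ub w (D'D _ D'w)) bD).
have compat x (D'x : D' x) : F x * pdr true G x = G x * pdr true F x /\
    F x * pdr true (pdr true F) x - pdr true F x * pdr true F x = 2 * F x * (G x * G x) := weingarten_compatibility oD' (res _ sl) (res _ sk) (res _ sH)
  (res _ su) (res _ sb) (fun w D'w => ky (D'D _ D'w)) (fun w D'w => density_y (D'D _ D'w))
  (fun w D'w => Hy0 _ (D'D _ D'w)) (fun w D'w => uy _ (D'D _ D'w))
  (fun w D'w => ux _ (D'D _ D'w)) (fun w D'w => ub _ (D'D _ D'w)) bD gD D'x.
have Dline t (vt : near_pt (complex.Re v) e t) : D' (t +i* complex.Im v).
  by apply: eD; split => //; rewrite /= subrr normr0.
(* The identity F G_x = G F_x makes G / F constant on the horizontal line through v. *)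
pose C := G v / F v.
have GF t : near_pt (complex.Re v) e t -> G (t +i* complex.Im v) = C * F (t +i* complex.Im v).
  move=> vt; have D't := Dline t vt; have F0 := F_gt0 _ D't.
  suff : G (t +i* complex.Im v) * (F (t +i* complex.Im v))^-1 =
      G (complex.Re v +i* complex.Im v) * (F (complex.Re v +i* complex.Im v))^-1.
    rewrite cplx_eta -/C => <-; rewrite mulfVK //; first by rewrite gt_eqF.
  apply: (zero_derive_eq (f := fun t => G (t +i* complex.Im v) * (F (t +i* complex.Im v))^-1)
    (c := complex.Re v) (e := e)) => //; last by rewrite subrr normr0.
  move=> s vs; have D's := Dline s vs; have [c1 c2] := compat _ D's.
  have Fs : F (s +i* complex.Im v) != 0 by rewrite gt_eqF // F_gt0.
  have dV := derV (f := fun s => F (s +i* complex.Im v)) (t := s) Fs (line_der sF eD1 vs).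
  apply: (eq_der (derM (line_der sG eD1 vs) dV)).
  have -> : pdr true G (s +i* complex.Im v) = G (s +i* complex.Im v) *
      pdr true F (s +i* complex.Im v) / F (s +i* complex.Im v).
    by rewrite -c1 mulrAC mulfV // mul1r.
  move: Fs; move: (F _) (G _) (pdr true F _) => F1 G1 F2 Fs; by field.
exfalso; refine (@hcmu_line_absurd R (complex.Re v) e _ _ _ _ e0 (line_l_gt0 eD1)
  (line_k eD1) (line_der sl eD1) (line_der (smooth_pd true sl) eD1) (line_curvature eD1)
  c C (fun t => H (t +i* complex.Im v)) (fun t => F (t +i* complex.Im v)) _ _ _ _
  (line_der sF eD1) (line_der (smooth_pd true sF) eD1) _).
- by [].
(* The factor l cancels in l H_x = C l^2 (H^2 - k + c), which is G = C F. *)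
- move=> t vt; have Dt := line_in eD1 vt; apply: (eq_der (line_der sH eD1 vt)).
  apply: (mulfI (l_neq0 Dt)); rewrite -/(G _) (GF t vt) /F; ring.
- move=> t vt; have [_ ->] := compat _ (Dline t vt).
  by rewrite -/(G _) (GF t vt).
Qed.

End hcmu_weingarten.

(** * Immersions into space forms *)

Lemma smooth_on_cst (R : realType) (V : normedModType R) (D : set (cplx R)) (v : V) :
  open D -> smooth_on D (fun _ => v).
Proof.
move=> oD k; elim: k v => [|k IH] v; first by split => // w _; exact: cst_continuous.
apply/CkP; split=> [w _|b]; first exact: cst_continuous.
split=> [w _|]; first by case: b; exact: derivable_cst.
apply: (Ck_eq oD) (IH 0) => w _; rewrite pdE.
by case: b; rewrite /= derive1_cst.
Qed.

Section space_form_immersion.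
Context {R : realType}.
Variables (D : set (cplx R)) (c : R) (r N : cplx R -> 'rV[R]_4) (l : cplx R -> R).
Hypothesis oD : open D.
Hypotheses (sr : smooth_on D r) (sN : smooth_on D N) (sl : smooth D l).
Hypothesis l_gt0 : forall w, D w -> 0 < l w.
Hypothesis rxx : forall w, D w -> ambient c (pd true r w) (pd true r w) = l w.
Hypothesis rxy : forall w, D w -> ambient c (pd true r w) (pd false r w) = 0.
Hypothesis ryy : forall w, D w -> ambient c (pd false r w) (pd false r w) = l w.
Hypothesis NN : forall w, D w -> ambient c (N w) (N w) = 1.
Hypothesis Nr : forall b w, D w -> ambient c (N w) (pd b r w) = 0.
Hypothesis r_in : forall w, D w -> space_form c (r w).
Hypothesis N_tangent : forall w, D w -> space_form_tangent c (r w) (N w).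

Lemma space_form_equations w : D w ->
  let a := sff11 c r N in let b := sff12 c r N in let d := sff22 c r N in
  [/\ pdr false a w - pdr true b w = pdr false l w * (a w + d w) / (2 * l w),
      pdr true d w - pdr false b w = pdr true l w * (a w + d w) / (2 * l w) &
      a w * d w - b w ^+ 2 =
        - (pdr true (pdr true l) w + pdr false (pdr false l) w) / 2 +
        (pdr true l w ^+ 2 + pdr false l w ^+ 2) / (2 * l w) - c * l w ^+ 2].
Proof.
move=> Dw a b d.
suff [n [tau [nu [sn nn nr nN [dn nu0 tn]]]]] : exists (n : cplx R -> 'rV[R]_4) tau nu,
    [/\ smooth_on D n, forall w, D w -> ambient c (n w) (n w) = nu,
        forall b w, D w -> ambient c (n w) (pd b r w) = 0,
        forall w, D w -> ambient c (n w) (N w) = 0 &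
        [/\ forall b w, D w -> pd b n w = tau *: pd b r w,
            nu != 0 & tau ^+ 2 = c * nu]].
  split.
  - exact: (codazzi1 oD sr sN sn l_gt0 rxx rxy ryy NN Nr nn nr nN dn nu0 tn Dw).
  - exact: (codazzi2 oD sr sN sn l_gt0 rxx rxy ryy NN Nr nn nr nN dn nu0 tn Dw).
  - exact: (gauss oD sr sN sn sl l_gt0 rxx rxy ryy NN Nr nn nr nN dn nu0 tn Dw).
(* The normal is the first basis vector if c = 0. Otherwise it is the position vector, orthogonal to
   the surface because <r, r> = 1 / c is constant. *)
have [c0|c0] := eqVneq c 0.
  pose e : 'rV[R]_4 := delta_mx ord0 ord0.
  have eE v : ambient c e v = v ord0 ord0.
    rewrite /ambient c0 ltxx /= (bigD1 ord0) //= big1 => [|i i0]; last first.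
      by rewrite mxE (negPf i0) andbF mulr0 mul0r.
    by rewrite mxE !eqxx addr0 !mul1r.
  exists (fun _ => e), 0, 1; split; first exact: smooth_on_cst.
  - by move=> v _; rewrite eE mxE !eqxx.
  - move=> i v Dv; rewrite eE.
    have <- : pdr i (entry ord0 r) v = pd i r v ord0 ord0 := pdr_entry i ord0 sr Dv.
    have r0 x : D x -> entry ord0 r x = 0.
      by move=> Dx; have := r_in Dx; rewrite /space_form /= c0 eqxx.
    by rewrite (pdr_eq oD i r0 Dv) pdr_cst.
  - move=> v Dv; rewrite eE; have := N_tangent Dv.
    by rewrite /space_form_tangent /= c0 eqxx.
  - split; [|exact: oner_neq0|by rewrite c0 mul0r expr0n].
    by move=> i v _; rewrite scale0r pdE; case: i; rewrite /= derive1_cst.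
have rr w' : D w' -> ambient c (r w') (r w') = c^-1.
  by move=> Dw'; have := r_in Dw'; rewrite /space_form /= (negPf c0) => -[].
exists r, 1, c^-1; split => //.
- move=> i v Dv; have := pdr_ambient oD c i sr sr Dv.
  rewrite (pdr_eq oD i rr Dv) pdr_cst ambientC => /esym/eqP.
  by rewrite -mulr2n mulrn_eq0 => /eqP.
- by move=> v Dv; have := N_tangent Dv; rewrite /space_form_tangent /= (negPf c0).
- split; first by move=> i v _; rewrite scale1r.
    by rewrite invr_eq0.
  by rewrite expr1n mulfV.
Qed.

End space_form_immersion.

(** * Curvature and gradient field of a conformal metric *)

Section conformal_curvature.
Context {R : realType}.
Variables (D : set (cplx R)) (l : cplx R -> R).
Hypothesis oD : open D.
Hypothesis sl : smooth D l.
Hypothesis l_gt0 : forall w, D w -> 0 < l w.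

Let l_neq0 w : D w -> l w != 0. Proof. by move=> Dw; rewrite gt_eqF ?l_gt0. Qed.

Let exponent_pd i w : D w ->
  pdr i (conf_exponent l) w = pdr i l w * (l w)^-1 * 2^-1.
Proof.
move=> Dw; apply/has_pdE; rewrite /conf_exponent.
have d1 : is_derive (line i l w (coordc i w)) (1 : R) (@ln R) (l w)^-1.
  by rewrite line_self; apply: is_derive1_ln; exact: l_gt0.
have d2 := is_derive1_comp d1 (smooth_has_pd i sl Dw).
have d3 : has_pd i (fun v => ln (l v)) w ((l w)^-1 * pdr i l w).
  by rewrite /has_pd; case: i d1 d2.
have := has_pdM d3 (has_pd_cst i (2^-1) w).
by rewrite mulr0 addr0 [_^-1 * pdr _ _ _]mulrC.
Qed.

Let curvatureE w : D w -> conf_curvature l w =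
  - (pdr true (fun v => pdr true l v * (l v)^-1 * 2^-1) w +
     pdr false (fun v => pdr false l v * (l v)^-1 * 2^-1) w) * (l w)^-1.
Proof.
move=> Dw; rewrite -(pdr_eq oD true (exponent_pd true) Dw).
by rewrite -(pdr_eq oD false (exponent_pd false) Dw).
Qed.

Lemma smooth_conf_curvature : smooth D (conf_curvature l).
Proof.
have slV := smoothV oD l_neq0 sl.
have s2 := smooth_cst oD (2^-1 : R).
have s i := smooth_pd i (smoothM oD (smoothM oD (smooth_pd i sl) slV) s2).
apply: (smooth_eq oD) (smoothM oD (smoothN oD (smoothD oD (s true) (s false))) slV).
by move=> w Dw; rewrite curvatureE.
Qed.

(** The curvature is minus the Laplacian of ln l divided by 2 l; the factor 2 l^3 clears the
    denominators. *)
Lemma conf_curvature_eq w : D w -> 2 * conf_curvature l w * (l w * l w * l w) =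
  pdr true l w * pdr true l w + pdr false l w * pdr false l w -
  (pdr true (pdr true l) w + pdr false (pdr false l) w) * l w.
Proof.
move=> Dw; have l0 := l_neq0 Dw; rewrite (curvatureE Dw).
have d i : pdr i (fun v => pdr i l v * (l v)^-1 * 2^-1) w =
    (pdr i (pdr i l) w * (l w)^-1 + pdr i l w * (- pdr i l w * ((l w)^-1 * (l w)^-1))) * 2^-1.
  have sli := smooth_pd i sl; have dV := has_pdV l0 (smooth_has_pd i sl Dw).
  apply: eq_has_pd.
    by apply: (has_pdM (has_pdM _ dV) (has_pd_cst _ _ _)); has_pd_solve.
  by rewrite mulr0 addr0.
rewrite !d; move: (pdr true (pdr true l) w) (pdr false (pdr false l) w) (pdr true l w)
  (pdr false l w) (l w) l0 => lxx lyy lx ly L L0.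
by field.
Qed.

End conformal_curvature.

(** The hypothesis says K_zbar = l / 4, and K_zbar = (K_x + i K_y) / 2: the real and imaginary parts
    are compared. *)
Lemma grad_coef_partials (R : realType) (l k : cplx R -> R) (w : cplx R) : l w != 0 ->
  grad_coef l k w = 'i%C / 4 -> pdr true k w = l w * 2^-1 /\ pdr false k w = 0.
Proof.
move=> l0 e.
set kx := pdr true k w; set ky := pdr false k w.
have dzE : dzbar (toC k) w = 2^-1 * (kx%:C + 'i * ky%:C)%C.
  rewrite /dzbar; congr (_ * (_ + _ * _)); apply/eqP; rewrite eq_complex /=.
    by rewrite eqxx; apply/eqP; exact: (pdr_cst true 0 w).
  by rewrite eqxx; apply/eqP; exact: (pdr_cst false 0 w).
move: e; rewrite /grad_coef dzE fmorphV /=.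
have L0 : (l w)%:C%C != 0 by rewrite fmorph_eq0.
have i0 : 'i%C != 0 :> R[i] by rewrite neq0Ci.
have [L LE] : exists L, L = (l w)%:C%C by exists (l w)%:C%C.
rewrite -LE in L0 *.
set X := (kx%:C + _)%C => e.
have : X = L / 2.
  have -> : X = ('i%C * L^-1 * (2^-1 * X)) * (2 * L / 'i%C) by field; rewrite L0 i0.
  by rewrite e; field; rewrite i0.
have -> : X = (kx +i* ky)%C by rewrite [RHS]complexE.
have -> : L / 2 = ((l w * 2^-1)%:C)%C by rewrite LE rmorphM fmorphV rmorph_nat.
by move=> /eqP; rewrite eq_complex /= => /andP[/eqP -> /eqP ->].
Qed.

(** Inserting the intrinsic curvature into the Gauss equation turns its right side into l^2 (k -
    c). *)
Lemma gauss_curvature_arith (R : realFieldType) (c k l lx ly lxx lyy : R) :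
  l != 0 -> 2 * k * (l * l * l) = lx * lx + ly * ly - (lxx + lyy) * l ->
  - (lxx + lyy) / 2 + (lx ^+ 2 + ly ^+ 2) / (2 * l) - c * l ^+ 2 =
  l * l * (k - c).
Proof.
move=> l0 e; have -> : k = (lx * lx + ly * ly - (lxx + lyy) * l) / (2 * (l * l * l)).
  by rewrite -e; field.
by field.
Qed.

(** * Reduction from the Riemann surface to functions on a plane domain *)

Theorem theorem2 (R : realType)
  (M : riemann_surface R) (M_compact : compact [set: M])
  (P : seq M) (g : conformal_metric P)
  (K : M -> R) (K_continuous : continuous (K : M -> R^o))
  (g_hcmu : is_hcmu g K)
  (K1 K2 : R) (K1_max : is_max K K1) (K2_min : is_min K K2)
  (omega : meromorphic_form M) (omega_char : is_character_form g K omega)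
  (z : chart R M) (z_coordinate : coordinate z)
  (U_connected : connected (dom z))
  (U_regular : dom z `<=` regular P)
  (U_Mstar : dom z `<=` ~` (form_zeros omega `|` form_poles omega))
  (omega_dz : forall w, img z w -> coef omega z w = 1)
  (c : R) (r : M -> 'rV[R]_4)
  (r_isometric : isometric_immersion z (density g z) c r)
  (N : M -> 'rV[R]_4) (N_normal : unit_normal z c r N) :
  weingarten z (density g z) c K r N <->
  (exists a : R, forall w, img z w -> h12 z c r N w = a).
Proof.
pose D := img z; pose l := density g z; pose k : cplx R -> R := in_chart z K.
have oD : open D by exact: img_open.
have chart_inv_in w : D w -> dom z (chart_inv z w) /\ Defs.coord z (chart_inv z w) = w.
  by move=> [p zp <-]; rewrite coordK.
have cD : connected D.
  apply: connected_continuous_connected => //.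
  by apply: continuous_in_subspaceT => p; rewrite inE; exact: Defs.coord_continuous.
have sl : smooth D l.
  by have := density_smooth g z_coordinate; rewrite (setIidl U_regular).
have l_gt0 w : D w -> 0 < l w.
  move=> /chart_inv_in[zw <-]; apply: density_gt0 => //; exact: U_regular.
have kE w : D w -> conf_curvature l w = k w.
  move=> /chart_inv_in[zw ww]; rewrite -{1}ww; apply/esym.
  by apply: (hcmu_curvature g_hcmu) => //; exact: U_regular.
(* K inherits its smoothness from the metric whose curvature it is. *)
have sk : smooth D k := smooth_eq oD kE (smooth_conf_curvature oD sl l_gt0).
have kxy w : D w -> pdr true k w = l w * 2^-1 /\ pdr false k w = 0.
  move=> Dw; have [zw ww] := chart_inv_in w Dw; apply: grad_coef_partials.
    by rewrite gt_eqF // l_gt0.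
  (* The identity defining the character form is stated off its poles, which [U_Mstar] excludes. *)
  have := omega_char z z_coordinate _ zw (U_regular _ zw).
  rewrite ww omega_dz // mul1r; apply=> pole.
  by apply: (U_Mstar _ zw); right.
have kx w (Dw : D w) := proj1 (kxy w Dw); have ky w (Dw : D w) := proj2 (kxy w Dw).
have curv w : D w -> 2 * k w * (l w * l w * l w) =
    pdr true l w * pdr true l w + pdr false l w * pdr false l w -
    (pdr true (pdr true l) w + pdr false (pdr false l) w) * l w.
  by move=> Dw; rewrite -(kE w Dw); exact: (conf_curvature_eq oD sl l_gt0 Dw).
case: r_isometric => sr r_in rxx rxy ryy; case: N_normal => sN N_tan NN Nx Ny.
have Nr b w : D w -> ambient c (in_chart z N w) (pd b (in_chart z r) w) = 0.
  by case: b; [exact: Nx|exact: Ny].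
have eqs w (Dw : D w) := space_form_equations oD sr sN sl l_gt0 rxx rxy ryy
  (fun w Dw => NN _ (proj1 (chart_inv_in w Dw))) Nr
  (fun w Dw => r_in _ (proj1 (chart_inv_in w Dw)))
  (fun w Dw => N_tan _ (proj1 (chart_inv_in w Dw))) Dw.
pose a := sff11 c (in_chart z r) (in_chart z N).
pose b := sff12 c (in_chart z r) (in_chart z N).
pose d := sff22 c (in_chart z r) (in_chart z N).
have sa : smooth D a := smooth_sff11 c oD sr sN.
have sb : smooth D b := smooth_sff12 c oD sr sN.
have sd : smooth D d := smooth_sff22 c oD sr sN.
have cod1 w (Dw : D w) : pdr false a w - pdr true b w =
  pdr false l w * (a w + d w) / (2 * l w) by case: (eqs w Dw).
have cod2 w (Dw : D w) : pdr true d w - pdr false b w =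
  pdr true l w * (a w + d w) / (2 * l w) by case: (eqs w Dw).
have gau w : D w -> a w * d w - b w * b w = l w * l w * (k w - c).
  move=> Dw; case: (eqs w Dw) => _ _; rewrite -/(a w) -/(b w) -/(d w) expr2 => ->.
  have := curv w Dw; have : l w != 0 by rewrite gt_eqF // l_gt0.
  exact: gauss_curvature_arith.
have HE w : D w -> mean_curvature z l c r N w = (a w + d w) * (2^-1 * (l w)^-1).
  by move=> _; rewrite /mean_curvature invfM.
(* As K_x = l / 2 > 0 and K_y = 0, the form dK /\ dH has coefficient (l / 2) H_y and vanishes
   exactly when H_y does. *)
have WE : weingarten z l c K r N <->
    forall w, D w -> pdr false (fun w => (a w + d w) * (2^-1 * (l w)^-1)) w = 0.
  pose Hm : cplx R -> R := mean_curvature z l c r N.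
  have WD w : D w -> pdr true k w * pdr false Hm w - pdr false k w * pdr true Hm w =
      l w * 2^-1 * pdr false (fun w => (a w + d w) * (2^-1 * (l w)^-1)) w.
    by move=> Dw; rewrite (kx w Dw) (ky w Dw) mul0r subr0 (pdr_eq oD false HE Dw).
  split=> [W w Dw|W kk HH w Dw].
    have /eqP := etrans (esym (WD w Dw)) (W w Dw).
    by rewrite !mulf_eq0 invr_eq0 pnatr_eq0 orbF gt_eqF ?l_gt0 //= => /eqP.
  by apply: etrans (WD w Dw) _; rewrite (W w Dw) mulr0.
split=> [/WE W|[a0 bE]].
  exact: (weingarten_constant_h12 oD cD sl sk sa sb sd l_gt0 kx ky curv cod1 cod2 gau W).
apply/WE; exact: (constant_h12_weingarten oD sl sk sa sb sd l_gt0 kx ky curv cod1 gau bE).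
Qed.
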